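(* Let $L$ be a logical system of dimension $d_L$, let $\mathcal{E}$ be any encoding channel from $L$ and $\mathcal{N}$ any noise channel, and let $\widehat{\mathcal{N}\circ\mathcal{E}}$ be a complementary channel of $\mathcal{N}\circ\mathcal{E}$. Fix a basis $\{|x\rangle\}$ of $L$ and define $\rho^{x,x'}=\widehat{\mathcal{N}\circ\mathcal{E}}(|x\rangle\langle x'|)$. Suppose there is a state $\zeta$ and constants $\epsilon,\nu\geq0$ such that $F(\rho^{x,x},\zeta)\geq\sqrt{1-\epsilon^2}$ for all $x$ and $\|\rho^{x,x'}\|_1\leq\nu$ for all $x\neq x'$. Then $$\epsilon_{\mathrm{worst}}(\mathcal{N}\circ\mathcal{E})\leq\epsilon+d_L\sqrt{\nu}.$$ Moreover, if the noise is $\mathcal{N}(\cdot)=\sum_\alpha q_\alpha|\alpha\rangle\langle\alpha|_C\otimes\mathcal{N}^\alpha(\cdot)$ for a probability distribution $\{q_\alpha\}$, orthonormal record states $|\alpha\rangle_C$ and channels $\mathcal{N}^\alpha$, and for each $\alpha$ there is a state $\zeta_\alpha$ such that the operators $\rho_\alpha^{x,x'}=\widehat{\mathcal{N}^\alpha\circ\mathcal{E}}(|x\rangle\langle x'|)$ satisfy $F(\rho_\alpha^{x,x},\zeta_\alpha)\geq\sqrt{1-\epsilon^2}$ for all $x$ and $\|\rho_\alpha^{x,x'}\|_1\leq\nu$ for all $x\neq x'$, then $\epsilon_{\mathrm{worst}}(\mathcal{N}\circ\mathcal{E})\leq\epsilon+d_L\sqrt{\nu}$.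
   Context: A complementary channel of a channel $\mathcal{F}(\cdot)=\operatorname{tr}_E(W(\cdot)W^\dagger)$ with Stinespring isometry $W:X\to B\otimes E$ is $\hat{\mathcal{F}}(\cdot)=\operatorname{tr}_B(W(\cdot)W^\dagger)$. Fidelity $F(\rho,\sigma)=\|\sqrt\rho\sqrt\sigma\|_1$. For channels $\mathcal{K},\mathcal{K}'$ with input $L$ and pure state $|\phi\rangle_{LR}$, $F_{|\phi\rangle}(\mathcal{K},\mathcal{K}')=F((\mathcal{K}\otimes\mathrm{id}_R)(\phi),(\mathcal{K}'\otimes\mathrm{id}_R)(\phi))$. For a channel $\mathcal{M}$ from $L$ to $B$: $f_{\mathrm{worst}}(\mathcal{M})=\max_{\mathcal{R}}\min_{|\phi\rangle}F_{|\phi\rangle}(\mathcal{R}\circ\mathcal{M},\mathrm{id}_L)$ over recovery channels $\mathcal{R}:B\to L$ and pure states $|\phi\rangle$ on $L$ and a reference; $\epsilon_{\mathrm{worst}}(\mathcal{M})=\sqrt{1-f_{\mathrm{worst}}^2(\mathcal{M})}$. *)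

(* Defs.v *)
From HB Require Import structures.
From mathcomp Require Import all_boot all_order all_algebra.
From mathcomp Require Import complex mxtens.
From mathcomp Require Import boolp classical_sets reals.

Set Implicit Arguments.
Unset Strict Implicit.
Unset Printing Implicit Defensive.

Import Order.TTheory GRing.Theory Num.Theory.
Local Open Scope ring_scope.
Local Open Scope classical_set_scope.

Section QInfo.
Variable R : realType.
Local Notation C := R[i].

Definition adj {m n} (A : 'M[C]_(m, n)) : 'M[C]_(n, m) := (map_mx Num.conj A)^T.

(* positive semidefinite operators (over C this forces hermiticity) *)
Definition psd {n} (A : 'M[C]_n) : Prop :=
  forall v : 'cV[C]_n, 0 <= (adj v *m A *m v) 0 0.

Definition density {n} (rho : 'M[C]_n) : Prop := psd rho /\ \tr rho = 1.

Definition isometry {m n} (W : 'M[C]_(m, n)) : Prop := adj W *m W = 1%:M.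

Definition ptrace2 {m k} (X : 'M[C]_(m * k)) : 'M[C]_m :=
  \matrix_(i, j) \sum_(e < k) X (mxtens_index (i, e)) (mxtens_index (j, e)).
Definition ptrace1 {m k} (X : 'M[C]_(m * k)) : 'M[C]_k :=
  \matrix_(i, j) \sum_(b < m) X (mxtens_index (b, i)) (mxtens_index (b, j)).

(* the (unique) positive semidefinite square root of a psd matrix *)
Definition psd_sqrt {n} (A : 'M[C]_n) : 'M[C]_n :=
  xget 0 [set S : 'M[C]_n | psd S /\ S *m S = A].

Definition trace_norm {m n} (A : 'M[C]_(m, n)) : R :=
  complex.Re (\tr (psd_sqrt (adj A *m A))).

Definition fidelity {n} (rho sigma : 'M[C]_n) : R :=
  trace_norm (psd_sqrt rho *m psd_sqrt sigma).

(* quantum channels, given by a Stinespring isometry W : X -> B (x) E,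
   F(.) = tr_E (W . W^+) *)
Definition is_channel {n m} (Phi : 'M[C]_n -> 'M[C]_m) : Prop :=
  exists dE : nat, exists W : 'M[C]_(m * dE, n),
    isometry W /\ forall X, Phi X = ptrace2 (W *m X *m adj W).

Definition is_complementary {n m dE} (Phi : 'M[C]_n -> 'M[C]_m)
    (Psi : 'M[C]_n -> 'M[C]_dE) : Prop :=
  exists W : 'M[C]_(m * dE, n), isometry W /\
    (forall X, Phi X = ptrace2 (W *m X *m adj W)) /\
    (forall X, Psi X = ptrace1 (W *m X *m adj W)).

Definition tens_id {n m} (K : 'M[C]_n -> 'M[C]_m) (dR : nat)
    (X : 'M[C]_(n * dR)) : 'M[C]_(m * dR) :=
  \sum_(r < dR) \sum_(s < dR)
    (K (\matrix_(i, j) X (mxtens_index (i, r)) (mxtens_index (j, s))))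
      *t (delta_mx r s : 'M[C]_dR).
Arguments tens_id {n m} K dR X.

Definition ent_fidelity {n m} (dR : nat) (phi : 'cV[C]_(n * dR))
    (K K' : 'M[C]_n -> 'M[C]_m) : R :=
  fidelity (tens_id K dR (phi *m adj phi)) (tens_id K' dR (phi *m adj phi)).

(* f_worst(M) = max_Rec min_phi F_phi(Rec o M, id_L), the min ranging over
   all reference systems R (any dimension dR) and unit vectors phi on L (x) R;
   max/min are rendered as sup/inf *)
Definition f_worst {dL dB} (M : 'M[C]_dL -> 'M[C]_dB) : R :=
  sup [set f : R | exists Rec : 'M[C]_dB -> 'M[C]_dL, is_channel Rec /\
    f = inf [set g : R | exists dR : nat, exists phi : 'cV[C]_(dL * dR),
              adj phi *m phi = 1%:M /\ g = ent_fidelity phi (Rec \o M) id]].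

Definition eps_worst {dL dB} (M : 'M[C]_dL -> 'M[C]_dB) : R :=
  Num.sqrt (1 - f_worst M ^+ 2).

End QInfo.

(* Main.v *)
(** Let M have Kraus operators M_e, in a basis where kets are x, and put
    (B_x)_(e,b) = (M_e)_(b,x), so that the complementary channel has blocks
    rho^(x,x') = B_x B_x'^+.  Stack the B_x into BB : L E x B and let
    Gamma = BB BB^+, a matrix with blocks rho^(x,x').  The recovery is
    explicit, which avoids any minimax argument: the polar decomposition
    provides a contraction V with BB V = sqrt Gamma, and Uhlmann contractions
    Q_x, applied conditionally on x, rotate sqrt rho^(x,x) towards sqrt zeta.
    Let D be the block diagonal of Gamma.  By Powers and Stormer,
    |sqrt Gamma - sqrt D|_2^2 is at most |Gamma - D|_1 <= d_L^2 nu.  For every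
    input state the output is thus at sine distance at most d_L sqrt nu from
    the output with sqrt D in place of sqrt Gamma, which is itself at sine
    distance at most eps from the ideal output; the triangle inequality
    concludes.  With a classical record alpha, one reads alpha and applies the
    recovery of N^alpha: squared fidelities average with weights q_alpha. *)
Require Import Defs.
From HB Require Import structures.
From mathcomp Require Import all_boot all_order all_algebra.
From mathcomp Require Import complex mxtens spectral sesquilinear.
From mathcomp Require Import ring.
From mathcomp Require Import boolp classical_sets reals.

Set Implicit Arguments.
Unset Strict Implicit.
Unset Printing Implicit Defensive.

Import Order.TTheory GRing.Theory Num.Theory.
Local Open Scope ring_scope.

(** * The Frobenius inner product *)
Section Adjoint.
Variable R : realType.
Local Notation C := R[i].

Lemma adjE m n (A : 'M[C]_(m, n)) i j : adj A i j = (A j i)^*.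
Proof. by rewrite !mxE. Qed.

Lemma adjK m n (A : 'M[C]_(m, n)) : adj (adj A) = A.
Proof. by apply/matrixP => i j; rewrite !adjE conjCK. Qed.

Lemma adjM m n p (A : 'M[C]_(m, n)) (B : 'M[C]_(n, p)) :
  adj (A *m B) = adj B *m adj A.
Proof. by rewrite /adj map_mxM trmx_mul. Qed.

Lemma adjD m n (A B : 'M[C]_(m, n)) : adj (A + B) = adj A + adj B.
Proof. by rewrite /adj map_mxD linearD. Qed.

Lemma adjB m n (A B : 'M[C]_(m, n)) : adj (A - B) = adj A - adj B.
Proof. by rewrite /adj map_mxB linearB. Qed.

Lemma adj_scale m n (c : C) (A : 'M[C]_(m, n)) : adj (c *: A) = c^* *: adj A.
Proof. by apply/matrixP => i j; rewrite !mxE rmorphM. Qed.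

Lemma adj0 m n : adj (0 : 'M[C]_(m, n)) = 0.
Proof. by apply/matrixP => i j; rewrite !mxE rmorph0. Qed.

Lemma adj_id n : adj (1%:M : 'M[C]_n) = 1%:M.
Proof. by rewrite /adj map_mx1 trmx1. Qed.

Lemma adj_sum (I : finType) m n (F : I -> 'M[C]_(m, n)) :
  adj (\sum_i F i) = \sum_i adj (F i).
Proof. by apply: (big_morph _ (@adjD m n)); apply: adj0. Qed.

Lemma adj_tens m n p q (A : 'M[C]_(m, n)) (B : 'M[C]_(p, q)) :
  adj (A *t B) = adj A *t adj B.
Proof. by rewrite /adj map_mxT trmx_tens. Qed.

Lemma adj_diag n (d : 'rV[C]_n) : adj (diag_mx d) = diag_mx (map_mx Num.conj d).
Proof. by rewrite /adj map_diag_mx tr_diag_mx. Qed.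

Lemma adj_delta m n i j : adj (delta_mx i j : 'M[C]_(m, n)) = delta_mx j i.
Proof. by rewrite /adj map_delta_mx trmx_delta. Qed.

Lemma mxtrace_adj n (A : 'M[C]_n) : \tr (adj A) = (\tr A)^*.
Proof. by rewrite /adj mxtrace_tr raddf_sum; apply: eq_bigr => i _; rewrite mxE. Qed.

Definition fip m n (A B : 'M[C]_(m, n)) : C := \tr (adj A *m B).
Definition fnorm2 m n (A : 'M[C]_(m, n)) : C := fip A A.

Lemma fipC m n (A B : 'M[C]_(m, n)) : fip A B = (fip B A)^*.
Proof. by rewrite /fip -mxtrace_adj adjM adjK. Qed.

Lemma fipE m n (A B : 'M[C]_(m, n)) : fip A B = \sum_i \sum_j (A i j)^* * B i j.
Proof.
rewrite /fip exchange_big /=; apply: eq_bigr => j _.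
by rewrite mxE; apply: eq_bigr => i _; rewrite adjE.
Qed.

Lemma fipDr m n (A B B' : 'M[C]_(m, n)) : fip A (B + B') = fip A B + fip A B'.
Proof. by rewrite /fip mulmxDr linearD. Qed.

Lemma fipDl m n (A B B' : 'M[C]_(m, n)) : fip (B + B') A = fip B A + fip B' A.
Proof. by rewrite /fip adjD mulmxDl linearD. Qed.

Lemma fipZr m n (A B : 'M[C]_(m, n)) c : fip A (c *: B) = c * fip A B.
Proof. by rewrite /fip -scalemxAr linearZ. Qed.

Lemma fipZl m n (A B : 'M[C]_(m, n)) c : fip (c *: A) B = c^* * fip A B.
Proof. by rewrite /fip adj_scale -scalemxAl linearZ. Qed.

Lemma fip0r m n (A : 'M[C]_(m, n)) : fip A 0 = 0.
Proof. by rewrite /fip mulmx0 mxtrace0. Qed.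

Lemma fipBr m n (A B B' : 'M[C]_(m, n)) : fip A (B - B') = fip A B - fip A B'.
Proof. by rewrite /fip mulmxBr linearB. Qed.

Lemma fip_adj m n p (A : 'M[C]_(m, n)) (B : 'M[C]_(n, p)) (D : 'M[C]_(m, p)) :
  fip (A *m B) D = fip B (adj A *m D).
Proof. by rewrite /fip adjM mulmxA. Qed.

Lemma fnorm2E m n (A : 'M[C]_(m, n)) : fnorm2 A = \sum_i \sum_j `|A i j| ^+ 2.
Proof.
rewrite /fnorm2 fipE; apply: eq_bigr => i _; apply: eq_bigr => j _.
by rewrite normCKC.
Qed.

Lemma fnorm2_ge0 m n (A : 'M[C]_(m, n)) : 0 <= fnorm2 A.
Proof. by rewrite fnorm2E; do 2![apply: sumr_ge0 => ? _]; rewrite exprn_ge0. Qed.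

Lemma fnorm2_eq0 m n (A : 'M[C]_(m, n)) : fnorm2 A = 0 -> A = 0.
Proof.
rewrite fnorm2E => /eqP; rewrite psumr_eq0; last first.
  by move=> i _; apply: sumr_ge0 => ? _; rewrite exprn_ge0.
move=> /allP A0; apply/matrixP => i j; rewrite mxE.
have := A0 i (mem_index_enum _); rewrite psumr_eq0 => [/allP/(_ j (mem_index_enum _))|? _].
  by rewrite sqrf_eq0 normr_eq0 => /eqP.
by rewrite exprn_ge0.
Qed.

Lemma fnorm2_adj m n (A : 'M[C]_(m, n)) : fnorm2 (adj A) = fnorm2 A.
Proof. by rewrite /fnorm2 /fip adjK mxtrace_mulC. Qed.

Lemma fnorm2_col m n (A : 'M[C]_(m, n)) : fnorm2 A = \sum_j fnorm2 (col j A).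
Proof.
rewrite fnorm2E exchange_big; apply: eq_bigr => j _.
by rewrite fnorm2E; apply: eq_bigr => i _; rewrite big_ord1 mxE.
Qed.

(* Expanding |n A . B - <A, B> A|^2 >= 0 with n = |A|^2. *)
Lemma fip_CS m n (A B : 'M[C]_(m, n)) :
  `|fip A B| ^+ 2 <= fnorm2 A * fnorm2 B.
Proof.
have [A0|A_neq0] := eqVneq (fnorm2 A) 0.
  by rewrite A0 (fnorm2_eq0 A0) /fip adj0 mul0mx mxtrace0 normr0 expr0n mul0r.
have A_gt0 : 0 < fnorm2 A by rewrite lt_def A_neq0 fnorm2_ge0.
have Areal : (fnorm2 A)^* = fnorm2 A by apply/CrealP/ger0_real/fnorm2_ge0.
have := fnorm2_ge0 (fnorm2 A *: B + (- fip A B) *: A).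
rewrite {1}/fnorm2 !(fipDr, fipDl, fipZr, fipZl) rmorphN /= Areal.
rewrite -!/(fnorm2 _) [fip B A]fipC => h.
rewrite -subr_ge0 -(pmulr_rge0 _ A_gt0) normCK; move: h; congr (0 <= _).
by rewrite -!/(fnorm2 _); ring.
Qed.

(** Minkowski's inequality in squared form, so that no norm has to be extracted as a square root;
    Cauchy-Schwarz controls the cross terms. *)
Lemma fnorm2D_le m n (A B : 'M[C]_(m, n)) (a b : C) : 0 <= a -> 0 <= b ->
  fnorm2 A <= a ^+ 2 -> fnorm2 B <= b ^+ 2 -> fnorm2 (A + B) <= (a + b) ^+ 2.
Proof.
move=> a0 b0 hA hB.
have h : `|fip A B| <= a * b.
  rewrite -(@ler_pXn2r _ 2) ?nnegrE ?mulr_ge0 // (le_trans (fip_CS _ _)) //.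
  by rewrite exprMn ler_pM ?fnorm2_ge0.
rewrite /fnorm2 !(fipDl, fipDr) -!/(fnorm2 _) sqrrD.
rewrite [leLHS](_ : _ = fnorm2 A + (fip A B + fip B A) + fnorm2 B); last by ring.
apply: lerD => //; apply: lerD => //.
have fR : fip A B + fip B A \is Num.real.
  by rewrite CrealE rmorphD /= -!fipC addrC.
apply: le_trans (real_ler_norm fR) _.
rewrite (le_trans (ler_normD _ _)) // [fip B A]fipC norm_conjC -mulr2n.
by rewrite lerMn2r h.
Qed.

(* The sine distance sqrt (1 - |<o, t>|^2) is the norm of the component of t
   orthogonal to the unit vector o, and decomposing t along s bounds it. *)
Lemma sine_triangle m n (s t o : 'M[C]_(m, n)) (e w : C) :
  fnorm2 o = 1 -> fnorm2 s = 1 -> fnorm2 t <= 1 -> 0 <= e -> 0 <= w ->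
  1 - e ^+ 2 <= `|fip s t| ^+ 2 -> fnorm2 (s - o) <= w ^+ 2 ->
  1 - (e + w) ^+ 2 <= `|fip o t| ^+ 2.
Proof.
move=> o1 s1 t1 e0 w0 hst hso.
(* [q] projects onto the orthogonal complement of the unit vector o. *)
pose q (x : 'M[C]_(m, n)) := x - fip o x *: o.
have qE x : fnorm2 (q x) = fnorm2 x - `|fip o x| ^+ 2.
  rewrite /q -scaleNr /fnorm2 !(fipDl, fipDr, fipZl, fipZr) -!/(fnorm2 _) o1.
  by rewrite [fip x o]fipC normCK rmorphN /=; ring.
have q_le x : fnorm2 (q x) <= fnorm2 x by rewrite qE gerBl exprn_ge0.
set c := fip s t in hst *.
have c_le1 : `|c| ^+ 2 <= 1.
  by rewrite (le_trans (fip_CS _ _)) // s1 mul1r.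
have tsE : fnorm2 (t - c *: s) = fnorm2 t - `|c| ^+ 2.
  rewrite -scaleNr /fnorm2 !(fipDl, fipDr, fipZl, fipZr) -!/(fnorm2 _) s1.
  by rewrite [fip t s]fipC -/c normCK rmorphN /=; ring.
(* [q] is linear and kills o, so q s = q (s - o); it is applied to t = c s + (t - c s), the second
   term being orthogonal to s. *)
have qt : q t = c *: q (s - o) + q (t - c *: s).
  apply/eqP; rewrite /q !fipBr fipZr -/(fnorm2 o) o1; apply/eqP/matrixP => i j.
  by rewrite !mxE; ring.
pose b := sqrtC (fnorm2 t - `|c| ^+ 2).
have b2 : b ^+ 2 = fnorm2 t - `|c| ^+ 2 by rewrite sqrtCK.
have b0 : 0 <= b by rewrite sqrtC_ge0 -tsE fnorm2_ge0.
have be : b <= e.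
  rewrite -(@ler_pXn2r _ 2) ?nnegrE // b2 (le_trans (lerB t1 (lexx _))) //.
  by rewrite lerBlDr -lerBlDl.
have : fnorm2 (q t) <= (w + b) ^+ 2.
  rewrite qt; apply: fnorm2D_le => //.
    rewrite /fnorm2 fipZl fipZr -/(fnorm2 _) mulrA -normCKC.
    rewrite -[w ^+ 2]mul1r ler_pM ?exprn_ge0 ?fnorm2_ge0 //.
    by rewrite (le_trans (q_le _)).
  by rewrite b2 -tsE q_le.
rewrite qE lerBlDr -lerBlDl; apply: le_trans.
rewrite -subr_ge0.
(* Substituting |t|^2 = b^2 + |c|^2 cancels b^2 and leaves two nonnegative terms; this covers a
   subnormalized t as well. *)
have -> : fnorm2 t - (w + b) ^+ 2 - (1 - (e + w) ^+ 2)
   = (e ^+ 2 - (1 - `|c| ^+ 2)) + 2%:R * w * (e - b).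
  have -> : fnorm2 t = b ^+ 2 + `|c| ^+ 2 by rewrite b2 subrK.
  by ring.
rewrite addr_ge0 //; first by rewrite subr_ge0 lerBlDr -lerBlDl.
by rewrite !mulr_ge0 // subr_ge0.
Qed.

End Adjoint.
(** * Positive semidefinite matrices and the trace norm *)
Section Psd.
Variable R : realType.
Local Notation C := R[i].

Lemma mxtrace11 (c : 'M[C]_1) : \tr c = c 0 0.
Proof. by rewrite /mxtrace big_ord1. Qed.

Lemma psdP n (A : 'M[C]_n) : psd A <-> forall v : 'cV_n, 0 <= fip v (A *m v).
Proof.
by split=> h v; have := h v; rewrite /fip mxtrace11 !mulmxA.
Qed.

Lemma quadratic_form_entry n (A : 'M[C]_n) i j (c : C) :
  fip (delta_mx i 0 + c *: delta_mx j 0) (A *m (delta_mx i 0 + c *: delta_mx j (0 : 'I_1)))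
  = A i i + c * A i j + c^* * A j i + c^* * c * A j j.
Proof.
have E k l : fip (delta_mx k (0 : 'I_1)) (A *m delta_mx l 0) = A k l.
  rewrite /fip mxtrace11 adj_delta -rowE -colE.
  by rewrite !mxE.
by rewrite mulmxDr -scalemxAr !(fipDl, fipDr, fipZl, fipZr) !E; ring.
Qed.

(* Polarization, with the vectors e_i + e_j and e_i + 'i e_j. *)
Lemma psd_adj n (A : 'M[C]_n) : psd A -> adj A = A.
Proof.
move=> /psdP Apsd; apply/matrixP => i j; rewrite adjE.
have re c : A i i + c * A i j + c^* * A j i + c^* * c * A j j \is Num.real.
  by rewrite -quadratic_form_entry ger0_real.
have diag k : (A k k)^* = A k k.
  apply/CrealP; rewrite ger0_real //; have := Apsd (delta_mx k 0).
  by rewrite /fip mxtrace11 adj_delta mulmxA -rowE -colE !mxE.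
have /CrealP := re 1; have /CrealP := re 'i.
rewrite !(rmorphD, rmorphM, conjCK, rmorph1) /= !diag conjCi rmorphN /= conjCi opprK => h1 h2.
(* With a = A_ij and b = A_ji, reality at c = 1 gives a' + b' = a + b, and at c = 'i it gives 'i (b'
   - a') = 'i (a - b). Adding 'i times the first to the second yields 2 'i b' = 2 'i a. *)
apply: (mulfI (_ : 2%:R * 'i != 0 :> C)).
  by rewrite mulf_neq0 ?pnatr_eq0 ?neq0Ci.
set a := A i j in h1 h2 *; set b := A j i in h1 h2 *.
set a' := a^* in h1 h2 *; set b' := b^* in h1 h2 *.
have e2 : a' + b' = a + b.
  apply: (addrI (A i i + A j j)); transitivity (A i i + 1 * a' + 1 * b' + 1 * 1 * A j j).
    by ring.
  by rewrite h2; ring.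
have e1 : 'i * b' - 'i * a' = 'i * a - 'i * b.
  apply: (addrI (A i i + 'i * (- 'i) * A j j)).
  transitivity (A i i + - 'i * a' + 'i * b' + 'i * - 'i * A j j); first by ring.
  by rewrite h1; ring.
have -> : 2%:R * 'i * b' = 'i * (a' + b') + ('i * b' - 'i * a') by ring.
by rewrite e2 e1; ring.
Qed.

Lemma hermitian_spectral n (A : 'M[C]_n) : adj A = A ->
  exists P : 'M[C]_n, exists d : 'rV[C]_n,
  [/\ P *m adj P = 1%:M, adj P *m P = 1%:M, forall i, d 0 i \is Num.real
    & A = adj P *m diag_mx d *m P].
Proof.
move=> Aherm.
have adjT m p (M : 'M[C]_(m, p)) : map_mx Num.conj (M^T) = adj M.
  by apply/matrixP => i j; rewrite !mxE.
have Ah : A \is hermsymmx.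
  by apply/is_hermitianmxP; rewrite expr0 scale1r adjT Aherm.
exists (spectralmx A), (spectral_diag A).
have PU := spectral_unitarymx A.
have P1 : spectralmx A *m adj (spectralmx A) = 1%:M.
  by move/unitarymxP: PU; rewrite adjT.
split=> //; first exact: mulmx1C.
  by move=> i; have /mxOverP := hermitian_spectral_diag_real Ah; apply.
have AE := orthomx_spectralP (hermitian_normalmx Ah).
by rewrite (invmx_unitary PU) adjT in AE; exact: AE.
Qed.

Lemma diag_mx_conj n (P : 'M[C]_n) (d : 'rV[C]_n) : P *m adj P = 1%:M ->
  P *m (adj P *m diag_mx d *m P) *m adj P = diag_mx d.
Proof. by move=> P1; rewrite !mulmxA P1 mul1mx -mulmxA P1 mulmx1. Qed.

Lemma fip_conj n (P A B : 'M[C]_n) :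
  fip (adj P *m A *m P) B = fip A (P *m B *m adj P).
Proof. by rewrite /fip !adjM adjK !mulmxA [RHS]mxtrace_mulC !mulmxA. Qed.

Lemma fip_diag n (d : 'rV[C]_n) (A : 'M[C]_n) :
  fip (diag_mx d) A = \sum_i (d 0 i)^* * A i i.
Proof.
by rewrite /fip adj_diag mul_diag_mx; apply: eq_bigr => i _; rewrite !mxE.
Qed.

Lemma psd_diag_ge0 n (A : 'M[C]_n) i : psd A -> 0 <= A i i.
Proof.
move=> /psdP/(_ (delta_mx i 0)).
by rewrite /fip mxtrace11 adj_delta mulmxA -rowE -colE !mxE.
Qed.

Lemma psd_trace_ge0 n (A : 'M[C]_n) : psd A -> 0 <= \tr A.
Proof. by move=> hA; apply: sumr_ge0 => i _; apply: psd_diag_ge0. Qed.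

Lemma psd_congr m n (A : 'M[C]_n) (X : 'M[C]_(n, m)) :
  psd A -> psd (adj X *m A *m X).
Proof.
by move=> /psdP hA; apply/psdP => v; have := hA (X *m v); rewrite fip_adj !mulmxA.
Qed.

Lemma psd_gram m n (X : 'M[C]_(m, n)) : psd (adj X *m X).
Proof. by apply/psdP => v; rewrite -mulmxA -fip_adj fnorm2_ge0. Qed.

Lemma psd_diag n (d : 'rV[C]_n) : (forall i, 0 <= d 0 i) -> psd (diag_mx d).
Proof.
move=> d_ge0; apply/psdP => v; rewrite fipE; apply: sumr_ge0 => i _.
rewrite big_ord1 mul_diag_mx mxE mulrCA mulr_ge0 //.
by rewrite mulrC -normCK exprn_ge0.
Qed.

Lemma psd_spectral n (A : 'M[C]_n) : psd A ->
  exists P : 'M[C]_n, exists d : 'rV[C]_n,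
  [/\ P *m adj P = 1%:M, adj P *m P = 1%:M, forall i, 0 <= d 0 i
    & A = adj P *m diag_mx d *m P].
Proof.
move=> hA; have [P [d [P1 P2 _ AE]]] := hermitian_spectral (psd_adj hA).
exists P, d; split=> // i.
have := psd_diag_ge0 i (psd_congr (adj P) hA).
by rewrite adjK AE diag_mx_conj // mxE eqxx.
Qed.

(** * Contractions and the Powers-Stormer inequality *)

Definition contraction m n (X : 'M[C]_(m, n)) :=
  forall v : 'cV[C]_n, fnorm2 (X *m v) <= fnorm2 v.

Lemma contractionM m n p (X : 'M[C]_(m, n)) (Y : 'M[C]_(n, p)) :
  contraction X -> contraction Y -> contraction (X *m Y).
Proof. by move=> hX hY v; rewrite -mulmxA (le_trans (hX _)). Qed.

Lemma contraction_fnorm2 m n p (X : 'M[C]_(m, n)) (Y : 'M[C]_(n, p)) :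
  contraction X -> fnorm2 (X *m Y) <= fnorm2 Y.
Proof.
move=> hX; rewrite !fnorm2_col; apply: ler_sum => j _.
by rewrite colE -mulmxA -colE; apply: hX.
Qed.

(** For w = X^+ v one has |w|^2 = <v, X w>, at most |v| |w| by Cauchy-Schwarz, and a factor |w|
    cancels. *)
Lemma contraction_adj m n (X : 'M[C]_(m, n)) : contraction X -> contraction (adj X).
Proof.
move=> hX v; set w := adj X *m v.
have wE : fnorm2 w = fip v (X *m w) by rewrite /fnorm2 {1}/w fip_adj adjK.
have := fnorm2_ge0 w; rewrite le_eqVlt => /predU1P[<-|w_gt0]; first exact: fnorm2_ge0.
have : `|fnorm2 w| ^+ 2 <= fnorm2 v * fnorm2 w.
  by rewrite {1}wE (le_trans (fip_CS _ _)) // ler_wpM2l ?fnorm2_ge0.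
by rewrite ger0_norm ?fnorm2_ge0 // expr2 ler_pM2r.
Qed.

Lemma isometry_contraction m n (X : 'M[C]_(m, n)) :
  adj X *m X = 1%:M -> contraction X.
Proof. by move=> hX v; rewrite {1}/fnorm2 fip_adj mulmxA hX mul1mx. Qed.

Lemma contraction_diag n (d : 'rV[C]_n) : (forall i, `|d 0 i| <= 1) ->
  contraction (diag_mx d).
Proof.
move=> hd v; rewrite !fnorm2E; apply: ler_sum => i _; rewrite !big_ord1.
rewrite mul_diag_mx mxE normrM exprMn ler_piMl ?exprn_ge0 //.
by rewrite exprn_ile1.
Qed.

Lemma psd_sub1_contraction m n (X : 'M[C]_(m, n)) :
  contraction X <-> psd (1%:M - adj X *m X).
Proof.
have E v : fip v ((1%:M - adj X *m X) *m v) = fnorm2 v - fnorm2 (X *m v).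
  rewrite /fnorm2 [in RHS]fip_adj mulmxBl mul1mx -mulmxA.
  by rewrite /fip mulmxBr linearB.
by split=> [hX|/psdP hX v]; [apply/psdP => v|]; have := hX v; rewrite ?E subr_ge0.
Qed.

(* Powers and Stormer: K is the sign of X - Y, and the diagonal entries of
   X^2 - Y^2 in an eigenbasis of X - Y are lam_i (X_ii + Y_ii). *)
Lemma powers_stormer n (X Y : 'M[C]_n) : psd X -> psd Y ->
  exists2 K : 'M[C]_n, contraction K & fnorm2 (X - Y) <= fip K (X *m X - Y *m Y).
Proof.
move=> hX hY; have XYh : adj (X - Y) = X - Y by rewrite adjB !psd_adj.
have [P [d [P1 P2 d_real XYE]]] := hermitian_spectral XYh.
pose s : 'rV[C]_n := \row_i (if 0 <= d 0 i then 1 else -1).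
exists (adj P *m diag_mx s *m P).
  apply: contractionM; first apply: contractionM.
  - by apply: isometry_contraction; rewrite adjK.
  - by apply: contraction_diag => i; rewrite mxE; case: ifP; rewrite ?normrN normr1.
  - exact: isometry_contraction.
pose X' := P *m X *m adj P; pose Y' := P *m Y *m adj P.
have X'ge i : 0 <= X' i i.
  by apply: psd_diag_ge0; rewrite /X' -{1}[P]adjK; apply: psd_congr.
have Y'ge i : 0 <= Y' i i.
  by apply: psd_diag_ge0; rewrite /Y' -{1}[P]adjK; apply: psd_congr.
have dE : X' - Y' = diag_mx d.
  by rewrite /X' /Y' -mulmxBl -mulmxBr XYE diag_mx_conj.
have conjM (A B : 'M[C]_n) : P *m (A *m B) *m adj P = (P *m A *m adj P) *m (P *m B *m adj P).
  by rewrite !mulmxA -[P *m A *m _ *m P]mulmxA P2 mulmx1.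
(* X^2 - Y^2 = X (X - Y) + (X - Y) Y, conjugated into the eigenbasis of X - Y. *)
have sqE : P *m (X *m X - Y *m Y) *m adj P = X' *m diag_mx d + diag_mx d *m Y'.
  rewrite mulmxBr mulmxBl !conjM -/X' -/Y' -dE mulmxBr mulmxBl.
  by rewrite addrA subrK.
have -> : fnorm2 (X - Y) = fnorm2 (diag_mx d).
  by rewrite XYE /fnorm2 fip_conj diag_mx_conj.
rewrite fip_conj sqE {sqE conjM}; clearbody X' Y'.
have entry i : (X' *m diag_mx d + diag_mx d *m Y') i i = d 0 i * (X' i i + Y' i i).
  by rewrite mxE mul_mx_diag mul_diag_mx !mxE; ring.
rewrite /fnorm2 !fip_diag; apply: ler_sum => i _.
rewrite entry !mxE eqxx mulr1n.
have d'E : d 0 i = X' i i - Y' i i.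
  by have := congr1 (fun M : 'M_n => M i i) dE; rewrite !mxE eqxx mulr1n.
have -> : (d 0 i)^* = d 0 i by apply/CrealP.
(* Both signs reduce to |d_i| <= X_ii + Y_ii, which holds because d_i = X_ii - Y_ii with both
   entries nonnegative. *)
case: ifP => [d_ge0|/negbT d_lt0].
  rewrite rmorph1 mul1r ler_wpM2l // [leLHS]d'E lerD2l.
  by rewrite (le_trans _ (Y'ge i)) ?oppr_le0.
rewrite rmorphN rmorph1 mulN1r -mulrN.
have d_le0 : d 0 i <= 0 by move: d_lt0; rewrite -real_ltNge ?real0 // => /ltW.
by rewrite ler_wnM2l // [leRHS]d'E opprD lerD2r (le_trans _ (X'ge i)) ?oppr_le0.
Qed.

(** When the squares agree, the upper bound of Powers and Stormer vanishes, and with it the norm of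
    X - Y. *)
Lemma psd_sqrt_unique n (X Y : 'M[C]_n) : psd X -> psd Y ->
  X *m X = Y *m Y -> X = Y.
Proof.
move=> hX hY XY; have [K _] := powers_stormer hX hY.
rewrite XY subrr /fip mulmx0 mxtrace0 => h; apply/eqP; rewrite -subr_eq0; apply/eqP.
by apply: fnorm2_eq0; apply/le_anti; rewrite h fnorm2_ge0.
Qed.

Lemma psd_sqrt_spec n (A : 'M[C]_n) : psd A ->
  psd (psd_sqrt A) /\ psd_sqrt A *m psd_sqrt A = A.
Proof.
move=> hA; have [P [d [P1 P2 d_ge0 AE]]] := psd_spectral hA.
pose r : 'rV[C]_n := \row_i sqrtC (d 0 i).
(* [psd_sqrt] is a choice from this set, so one explicit member suffices: the root taken on
   eigenvalues. *)
suff : [set S : 'M[C]_n | psd S /\ S *m S = A]%classic (adj P *m diag_mx r *m P).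
  by move=> h; have := xgetPex 0 (ex_intro _ _ h).
split; first by apply/psd_congr/psd_diag => i; rewrite mxE sqrtC_ge0.
rewrite AE !mulmxA -[_ *m P *m adj P]mulmxA P1 mulmx1 -[X in X *m P]mulmxA.
congr (_ *m _ *m _); rewrite mulmx_diag; congr diag_mx.
by apply/rowP => i; rewrite !mxE -expr2 sqrtCK.
Qed.

Lemma psd_psd_sqrt n (A : 'M[C]_n) : psd A -> psd (psd_sqrt A).
Proof. by case/psd_sqrt_spec. Qed.

Lemma psd_sqrtK n (A : 'M[C]_n) : psd A -> psd_sqrt A *m psd_sqrt A = A.
Proof. by case/psd_sqrt_spec. Qed.

Lemma adj_psd_sqrt n (A : 'M[C]_n) : psd A -> adj (psd_sqrt A) = psd_sqrt A.
Proof. by move=> /psd_psd_sqrt/psd_adj. Qed.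

Lemma psd_sqrtE n (A S : 'M[C]_n) : psd S -> S *m S = A -> psd_sqrt A = S.
Proof.
move=> hS SA; have hA : psd A by rewrite -SA -{1}(psd_adj hS); apply: psd_gram.
by apply: psd_sqrt_unique; rewrite ?psd_sqrtK ?SA //; apply: psd_psd_sqrt.
Qed.

Lemma fnorm2_psd_sqrt n (A : 'M[C]_n) : psd A -> fnorm2 (psd_sqrt A) = \tr A.
Proof. by move=> hA; rewrite /fnorm2 /fip adj_psd_sqrt // psd_sqrtK. Qed.

(** * The trace norm and its pairing with contractions *)

Lemma trace_normE m n (A : 'M[C]_(m, n)) :
  ((trace_norm A)%:C)%C = \tr (psd_sqrt (adj A *m A)).
Proof.
rewrite /trace_norm RRe_real // ger0_real // psd_trace_ge0 //.
by apply/psd_psd_sqrt/psd_gram.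
Qed.

Lemma trace_norm_ge0 m n (A : 'M[C]_(m, n)) : 0 <= trace_norm A.
Proof.
by rewrite -ler0c trace_normE psd_trace_ge0 //; apply/psd_psd_sqrt/psd_gram.
Qed.

(** Let e_i be eigenvectors of |A| with eigenvalues d_i. Then |A e_i| = d_i, so each term <K e_i, A
    e_i> of the trace is at most d_i by Cauchy-Schwarz, and the d_i sum to the trace norm. *)
Lemma fip_le_trace_norm m n (K A : 'M[C]_(m, n)) : contraction K ->
  `|fip K A| <= ((trace_norm A)%:C)%C.
Proof.
move=> hK; rewrite trace_normE; set H := psd_sqrt _.
have hH : psd H by apply/psd_psd_sqrt/psd_gram.
have [P [d [P1 P2 d_ge0 HE]]] := psd_spectral hH.
have -> : \tr H = \sum_i d 0 i.
  by rewrite HE mxtrace_mulC !mulmxA P1 mul1mx mxtrace_diag.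
have -> : fip K A = \sum_i fip (K *m col i (adj P)) (A *m col i (adj P)).
  transitivity (fip (K *m adj P) (A *m adj P)).
    by rewrite /fip adjM adjK -[in RHS]mulmxA [RHS]mxtrace_mulC -!mulmxA P2 mulmx1.
  rewrite fipE exchange_big; apply: eq_bigr => i _; rewrite fipE; apply: eq_bigr => j _.
  by rewrite big_ord1 !colE !mulmxA -!colE !mxE.
apply: le_trans (ler_norm_sum _ _ _) _; apply: ler_sum => i _.
have c1 : fnorm2 (col i (adj P)) = 1.
  have := congr1 (fun M : 'M_n => M i i) P1; rewrite !mxE eqxx mulr1n => <-.
  by rewrite fnorm2E; apply: eq_bigr => j _; rewrite big_ord1 !mxE norm_conjC normCK.
have Hc : H *m col i (adj P) = d 0 i *: col i (adj P).
  rewrite colE mulmxA {1}HE -[_ *m P *m _]mulmxA P1 mulmx1 -!colE.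
  by rewrite mul_mx_diag; apply/colP => j; rewrite !mxE mulrC.
have d2 : fnorm2 (A *m col i (adj P)) = d 0 i ^+ 2.
  rewrite /fnorm2 fip_adj mulmxA -(psd_sqrtK (psd_gram A)) -/H -mulmxA.
  rewrite -{1}(psd_adj hH) -fip_adj Hc fipZl fipZr -/(fnorm2 _) c1 mulr1.
  by rewrite (CrealP _) ?ger0_real.
rewrite -(@ler_pXn2r _ 2) ?nnegrE // -d2 (le_trans (fip_CS _ _)) //.
by rewrite ler_piMl ?fnorm2_ge0 // (le_trans (hK _)) // c1.
Qed.

(* V is the generalized inverse of |A| times A^+. *)
Lemma polar_contraction m n (A : 'M[C]_(m, n)) :
  exists2 V : 'M[C]_(n, m), contraction V & V *m A = psd_sqrt (adj A *m A).
Proof.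
have hA := psd_gram A; set H := psd_sqrt _; have hH : psd H := psd_psd_sqrt hA.
have HH : H *m H = adj A *m A := psd_sqrtK hA.
have [P [d [P1 P2 d_ge0 HE]]] := psd_spectral hH.
(* Since 0^-1 = 0 here, [T] inverts H on its support and vanishes on its kernel, and [T *m H] is the
   support projection. *)
pose r : 'rV[C]_n := \row_i (d 0 i)^-1.
pose T := adj P *m diag_mx r *m P.
have Tadj : adj T = T.
  apply: psd_adj; apply/psd_congr/psd_diag => i; by rewrite mxE invr_ge0.
have TH : T *m H = adj P *m diag_mx (\row_i ((d 0 i)^-1 * d 0 i)) *m P.
  rewrite HE !mulmxA -[_ *m P *m adj P]mulmxA P1 mulmx1 -[X in X *m P]mulmxA.
  congr (_ *m _ *m _); rewrite mulmx_diag; congr diag_mx.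
  by apply/rowP => i; rewrite !mxE.
exists (T *m adj A).
  rewrite -[T *m _]adjK; apply: contraction_adj; rewrite adjM adjK Tadj => v.
  (* A and H = |A| give vectors of equal norm because A^+ A = H^2, so A T may be replaced by H T,
     the adjoint of the support projection. *)
  have -> : fnorm2 (A *m T *m v) = fnorm2 (H *m T *m v).
    by rewrite -!mulmxA /fnorm2 fip_adj [RHS]fip_adj !mulmxA (psd_adj hH) HH.
  apply: contraction_fnorm2; rewrite -[H *m T]adjK; apply: contraction_adj.
  rewrite adjM Tadj (psd_adj hH) TH; apply: contractionM; first apply: contractionM.
  - by apply: isometry_contraction; rewrite adjK.
  - apply: contraction_diag => i; rewrite mxE.
    by have [->|d0] := eqVneq (d 0 i) 0; rewrite ?mulr0 ?normr0 ?ler01 // mulVf // normr1.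
  - exact: isometry_contraction.
rewrite -mulmxA -HH mulmxA TH HE !mulmxA -[_ *m P *m adj P]mulmxA P1 mulmx1 -[X in X *m P]mulmxA.
congr (_ *m _ *m _); rewrite mulmx_diag; congr diag_mx.
apply/rowP => i; rewrite !mxE.
by have [->|d0] := eqVneq (d 0 i) 0; rewrite ?mulr0 // mulVf // mul1r.
Qed.

End Psd.
(** * Block matrices over a tensor product *)
Section Block.
Variable R : realType.
Local Notation C := R[i].

Lemma sum_mxtens (V : nmodType) m n (f : 'I_(m * n) -> V) :
  \sum_k f k = \sum_i \sum_j f (mxtens_index (i, j)).
Proof.
rewrite pair_big (reindex (@mxtens_index m n)) /=; last first.
  by exists (@mxtens_unindex m n) => k _; rewrite (mxtens_indexK, mxtens_unindexK).
by apply: eq_bigr => -[].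
Qed.

Definition blockmx m n p q (G : 'I_m -> 'I_n -> 'M[C]_(p, q)) : 'M[C]_(m * p, n * q) :=
  \matrix_(i, j) G (mxtens_unindex i).1 (mxtens_unindex j).1
                   (mxtens_unindex i).2 (mxtens_unindex j).2.

Definition block m n p q (A : 'M[C]_(m * p, n * q)) x y : 'M[C]_(p, q) :=
  \matrix_(i, j) A (mxtens_index (x, i)) (mxtens_index (y, j)).

Lemma blockmxE m n p q (G : 'I_m -> 'I_n -> 'M[C]_(p, q)) x i y j :
  blockmx G (mxtens_index (x, i)) (mxtens_index (y, j)) = G x y i j.
Proof. by rewrite mxE !mxtens_indexK. Qed.

Lemma blockmx_ext m n p q (A B : 'M[C]_(m * p, n * q)) :
  (forall x i y j, A (mxtens_index (x, i)) (mxtens_index (y, j))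
                 = B (mxtens_index (x, i)) (mxtens_index (y, j))) -> A = B.
Proof.
move=> AB; apply/matrixP => i j.
by case: (mxtens_indexP i) => x k; case: (mxtens_indexP j).
Qed.

Lemma blockK m n p q (A : 'M[C]_(m * p, n * q)) : blockmx (block A) = A.
Proof. by apply: blockmx_ext => x i y j; rewrite blockmxE mxE. Qed.

Lemma tens_blockmx m n p q (A : 'M[C]_(m, n)) (B : 'M[C]_(p, q)) :
  A *t B = blockmx (fun x y => A x y *: B).
Proof. by apply: blockmx_ext => x i y j; rewrite tensmxE blockmxE mxE. Qed.

Lemma blockmxM m n o p q r (G : 'I_m -> 'I_n -> 'M[C]_(p, q))
    (G' : 'I_n -> 'I_o -> 'M[C]_(q, r)) :
  blockmx G *m blockmx G' = blockmx (fun x z => \sum_y G x y *m G' y z).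
Proof.
apply: blockmx_ext => x i z j; rewrite blockmxE mxE sum_mxtens summxE.
apply: eq_bigr => y _; rewrite mxE; apply: eq_bigr => k _.
by rewrite !blockmxE.
Qed.

Lemma adj_blockmx m n p q (G : 'I_m -> 'I_n -> 'M[C]_(p, q)) :
  adj (blockmx G) = blockmx (fun x y => adj (G y x)).
Proof. by apply: blockmx_ext => x i y j; rewrite adjE !blockmxE adjE. Qed.

Lemma fip_blockmx m n p q (G G' : 'I_m -> 'I_n -> 'M[C]_(p, q)) :
  fip (blockmx G) (blockmx G') = \sum_x \sum_y fip (G x y) (G' x y).
Proof.
rewrite fipE sum_mxtens; apply: eq_bigr => x _.
under [RHS]eq_bigr do rewrite fipE.
rewrite [RHS]exchange_big; apply: eq_bigr => i _.
rewrite sum_mxtens; apply: eq_bigr => y _; apply: eq_bigr => j _.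
by rewrite !blockmxE.
Qed.

Lemma fnorm2_tens m n p q (A : 'M[C]_(m, n)) (B : 'M[C]_(p, q)) :
  fnorm2 (A *t B) = fnorm2 A * fnorm2 B.
Proof.
rewrite tens_blockmx /fnorm2 fip_blockmx fipE mulr_suml; apply: eq_bigr => x _.
by rewrite mulr_suml; apply: eq_bigr => y _; rewrite fipZl fipZr mulrA.
Qed.

Definition block_diag m p q (D : 'I_m -> 'M[C]_(p, q)) :=
  blockmx (fun x y => (x == y)%:R *: D x).

Lemma blockmx_diagM m n p q r (G : 'I_m -> 'I_n -> 'M[C]_(p, q)) (D : 'I_n -> 'M[C]_(q, r)) :
  blockmx G *m block_diag D = blockmx (fun x y => G x y *m D y).
Proof.
apply: blockmx_ext => x i z j; rewrite blockmxM !blockmxE (bigD1 z) //= big1.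
  by rewrite addr0 eqxx scale1r.
by move=> y /negbTE yz; rewrite yz scale0r mulmx0.
Qed.

Lemma adj_block_diag m p q (D : 'I_m -> 'M[C]_(p, q)) :
  adj (block_diag D) = block_diag (fun x => adj (D x)).
Proof.
rewrite adj_blockmx; apply: blockmx_ext => x i y j; rewrite !blockmxE adj_scale.
by rewrite rmorph_nat; have [->|_] := eqVneq x y; rewrite ?scale1r ?scale0r.
Qed.

Lemma block_diagM m p q r (D : 'I_m -> 'M[C]_(p, q)) (D' : 'I_m -> 'M[C]_(q, r)) :
  block_diag D *m block_diag D' = block_diag (fun x => D x *m D' x).
Proof.
rewrite blockmx_diagM; apply: blockmx_ext => x i y j; rewrite !blockmxE -scalemxAl.
by have [->|_] := eqVneq x y; rewrite ?scale1r ?scale0r.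
Qed.

Lemma psd_block_diag m p (D : 'I_m -> 'M[C]_p) : (forall x, psd (D x)) -> psd (block_diag D).
Proof.
move=> hD; have -> : block_diag D = adj (block_diag (fun x => psd_sqrt (D x)))
    *m block_diag (fun x => psd_sqrt (D x)).
  rewrite adj_block_diag block_diagM; apply: blockmx_ext => x i y j; rewrite !blockmxE.
  by rewrite adj_psd_sqrt // psd_sqrtK.
exact: psd_gram.
Qed.

Lemma contraction_block_diag m p q (D : 'I_m -> 'M[C]_(p, q)) :
  (forall x, contraction (D x)) -> contraction (block_diag D).
Proof.
move=> hD v; pose vx x : 'cV[C]_q := \col_j v (mxtens_index (x, j)) 0.
have -> : fnorm2 v = \sum_x fnorm2 (vx x).
  rewrite fnorm2E sum_mxtens; apply: eq_bigr => x _.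
  by rewrite fnorm2E; apply: eq_bigr => j _; rewrite !big_ord1 mxE.
have -> : fnorm2 (block_diag D *m v) = \sum_x fnorm2 (D x *m vx x).
  rewrite fnorm2E sum_mxtens; apply: eq_bigr => x _.
  rewrite fnorm2E; apply: eq_bigr => j _; rewrite !big_ord1 !mxE.
  congr (`|_| ^+ 2); rewrite sum_mxtens (bigD1 x) //= [X in _ + X]big1 ?addr0.
    by apply: eq_bigr => k _; rewrite blockmxE eqxx scale1r mxE.
  move=> y /negbTE yx; rewrite big1 // => k _.
  by rewrite blockmxE eq_sym yx scale0r mxE mul0r.
by apply: ler_sum => x _; apply: hD.
Qed.

(** A block is A sandwiched between the isometric insertions |z> (x) 1. *)
Lemma contraction_block m n p q (A : 'M[C]_(m * p, n * q)) x y :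
  contraction A -> contraction (block A x y).
Proof.
move=> hA; pose ins k l (z : 'I_k) : 'M[C]_(k * l, l) :=
  \matrix_(i, j) (i == mxtens_index (z, j))%:R.
have ins1 k l (z : 'I_k) : adj (@ins k l z) *m ins k l z = 1%:M.
  apply/matrixP => i j; rewrite !mxE (bigD1 (mxtens_index (z, j))) //= big1 ?addr0.
    rewrite adjE !mxE eqxx mulr1 (can_eq (@mxtens_indexK _ _)) xpair_eqE eqxx /=.
    by rewrite rmorph_nat eq_sym.
  by move=> a /negbTE h; rewrite [X in _ * X]mxE h mulr0.
have -> : block A x y = adj (ins m p x) *m A *m ins n q y.
  apply/matrixP => i j; rewrite !mxE (bigD1 (mxtens_index (y, j))) //= big1 ?addr0.
    rewrite [X in _ = _ * X]mxE eqxx mulr1 mxE (bigD1 (mxtens_index (x, i))) //= big1 ?addr0.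
      by rewrite adjE mxE eqxx rmorph1 mul1r.
    by move=> a /negbTE h; rewrite adjE mxE h rmorph0 mul0r.
  by move=> a /negbTE h; rewrite [X in _ * X]mxE h mulr0.
apply: contractionM; first apply: contractionM => //.
  exact/contraction_adj/isometry_contraction.
exact/isometry_contraction.
Qed.

(** Each entry of the product is the inner product of a row of A and a column of B, to which
    Cauchy-Schwarz applies. *)
Lemma fnorm2M_le m n p (A : 'M[C]_(m, n)) (B : 'M[C]_(n, p)) :
  fnorm2 (A *m B) <= fnorm2 A * fnorm2 B.
Proof.
rewrite fnorm2_col [fnorm2 B]fnorm2_col mulr_sumr; apply: ler_sum => k _.
rewrite fnorm2E [fnorm2 A]fnorm2E mulr_suml; apply: ler_sum => i _.
rewrite big_ord1 colE -mulmxA -colE.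
have -> : (A *m col k B) i 0 = fip (adj (row i A)) (col k B).
  by rewrite /fip adjK mxtrace11 !mxE; apply: eq_bigr => j _; rewrite !mxE.
rewrite (le_trans (fip_CS _ _)) // fnorm2_adj fnorm2E big_ord1.
by under eq_bigr do rewrite mxE.
Qed.

(** Reshaping v into a matrix w turns the action of H (x) 1 into the product H w, so
    submultiplicativity of the Frobenius norm applies. *)
Lemma contraction_tens1 m n p (H : 'M[C]_(m, n)) :
  fnorm2 H <= 1 -> contraction (H *t (1%:M : 'M[C]_p)).
Proof.
move=> hH v; pose w : 'M[C]_(n, p) := \matrix_(x, i) v (mxtens_index (x, i)) 0.
have -> : fnorm2 v = fnorm2 w.
  rewrite !fnorm2E sum_mxtens; apply: eq_bigr => x _; apply: eq_bigr => i _.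
  by rewrite big_ord1 mxE.
have -> : fnorm2 (H *t 1%:M *m v) = fnorm2 (H *m w).
  rewrite !fnorm2E sum_mxtens; apply: eq_bigr => r _; apply: eq_bigr => i _.
  rewrite big_ord1 !mxE; congr (`|_| ^+ 2); rewrite sum_mxtens; apply: eq_bigr => x _.
  rewrite (bigD1 i) //= big1 ?addr0; first by rewrite tensmxE !mxE eqxx mulr1.
  by move=> j /negbTE ji; rewrite tensmxE mxE eq_sym ji mulr0 mul0r.
by rewrite (le_trans (fnorm2M_le _ _)) // ler_piMl ?fnorm2_ge0.
Qed.

End Block.
(** * The explicit recovery *)
Section Recovery.
Variable R : realType.
Local Notation C := R[i].

Lemma psd_tr n (A : 'M[C]_n) : psd A -> psd A^T.
Proof.
move=> hA; rewrite -(psd_sqrtK hA) -{1}(adj_psd_sqrt hA) trmx_mul.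
set S := psd_sqrt A; have -> : S^T = adj (adj S)^T.
  by apply/matrixP => i j; rewrite !mxE conjCK.
exact: psd_gram.
Qed.

Lemma psd_sum (I : finType) n (A : I -> 'M[C]_n) : (forall i, psd (A i)) -> psd (\sum_i A i).
Proof.
move=> hA; apply/psdP => v; rewrite mulmx_suml /fip mulmx_sumr raddf_sum /=.
by apply: sumr_ge0 => i _; have /psdP := hA i; apply.
Qed.

(** The blocks of K are contractions, so each of the m^2 blocks of G contributes at most nu. The
    bound is written as a square to serve as the squared distance in [sine_triangle]. *)
Lemma trace_norm_blocks m p (K : 'M[C]_(m * p)) (G : 'I_m -> 'I_m -> 'M[C]_p) (nu : R) :
  contraction K -> 0 <= nu -> (forall x, G x x = 0) ->
  (forall x y, x != y -> trace_norm (G x y) <= nu) ->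
  `|fip K (blockmx G)| <= ((m%:R * Num.sqrt nu)%:C)%C ^+ 2.
Proof.
move=> hK nu0 G0 hG; rewrite -[K]blockK fip_blockmx.
apply: le_trans (ler_norm_sum _ _ _) _.
apply: (@le_trans _ _ (\sum_(x < m) \sum_(y < m) (nu%:C)%C)).
  apply: ler_sum => x _; apply: le_trans (ler_norm_sum _ _ _) _.
  apply: ler_sum => y _; have [->|xy] := eqVneq x y.
    by rewrite G0 fip0r normr0 ler0c.
  apply: le_trans (fip_le_trace_norm _ (contraction_block x y hK)) _.
  by rewrite lecR hG.
rewrite !sumr_const !card_ord -rmorphXn exprMn sqr_sqrtr //=.
by rewrite -!rmorphMn lecR -mulrnA -[X in X *+ _]mul1r -mulrnAl natrM expr2.
Qed.

(* The sum on the right of the conclusion is the squared entanglement fidelity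
   of the input state with matrix F (see [ent_fidelity_kraus]), where Rec is
   only subnormalized: [kraus_completion] makes it a channel. *)
Lemma recovery_kraus dL dB dE (M : 'I_dE -> 'M[C]_(dB, dL)) (zeta : 'M[C]_dE) (eps nu : R) :
  let B x : 'M[C]_(dE, dB) := \matrix_(i, b) M i b x in
  \sum_i adj (M i) *m M i = 1%:M -> density zeta -> 0 <= eps -> 0 <= nu ->
  (forall x, Num.sqrt (1 - eps ^+ 2) <= fidelity (B x *m adj (B x)) zeta) ->
  (forall x y, x != y -> trace_norm (B x *m adj (B y)) <= nu) ->
  exists2 Rec : 'I_dE -> 'M[C]_(dL, dB), psd (1%:M - \sum_j adj (Rec j) *m Rec j)
  & forall dR (F : 'M[C]_(dL, dR)), fnorm2 F = 1 ->
    1 - ((eps + dL%:R * Num.sqrt nu)%:C)%C ^+ 2 <=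
    \sum_j \sum_i `|\tr (Rec j *m M i *m (F *m adj F))| ^+ 2.
Proof.
move=> B hM [zeta_psd zeta_tr] eps0 nu0 hfid htr.
pose rho x y := B x *m adj (B y).
have rho_psd x : psd (rho x x) by rewrite /rho -{1}[B x]adjK; apply: psd_gram.
have rho_tr x y : \tr (rho x y) = (x == y)%:R.
  have := congr1 (fun A : 'M_dL => A y x) hM; rewrite summxE !mxE eq_sym => <-.
  apply: eq_bigr => i _; rewrite !mxE; apply: eq_bigr => b _.
  by rewrite !mxE mulrC.
pose Z := psd_sqrt zeta; have Zadj : adj Z = Z by apply: adj_psd_sqrt.
have Z1 : fnorm2 Z = 1 by rewrite fnorm2_psd_sqrt.
(* Uhlmann contractions: the trace of V_x sqrt(rho^(x,x)) sqrt(zeta) equals the fidelity of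
   rho^(x,x) and zeta. *)
have /choice[V hV] : forall x, exists V : 'M[C]_dE, contraction V /\
    V *m (psd_sqrt (rho x x) *m Z)
      = psd_sqrt (adj (psd_sqrt (rho x x) *m Z) *m (psd_sqrt (rho x x) *m Z)).
  by move=> x; have [V] := polar_contraction (psd_sqrt (rho x x) *m Z); exists V.
pose Q x := adj (V x).
pose BB : 'M[C]_(dL * dE, dB) := \matrix_(k, b) M (mxtens_unindex k).2 b (mxtens_unindex k).1.
have Gam : BB *m adj BB = blockmx rho.
  apply: blockmx_ext => x i y j; rewrite blockmxE !mxE; apply: eq_bigr => b _.
  by rewrite !mxE !mxtens_indexK.
have [V0 V0c V0E] := polar_contraction (adj BB); rewrite adjK in V0E.
have S_psd : psd (psd_sqrt (BB *m adj BB)).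
  by apply: psd_psd_sqrt; rewrite -{1}[BB]adjK; apply: psd_gram.
have SS : psd_sqrt (BB *m adj BB) *m psd_sqrt (BB *m adj BB) = blockmx rho.
  by rewrite psd_sqrtK -?Gam // -{1}[BB]adjK; apply: psd_gram.
set S := psd_sqrt _ in V0E S_psd SS.
have Sadj : adj S = S by apply: psd_adj.
(* [adj V0] turns BB into S = sqrt Gamma, and the block-diagonal factor then applies Q_x
   conditionally on x. *)
pose W := adj V0 *m block_diag Q.
have Wc : contraction W.
  apply: contractionM; first exact: contraction_adj.
  by apply: contraction_block_diag => x; apply/contraction_adj; case: (hV x).
have BW : BB *m W = S *m block_diag Q.
  by rewrite /W mulmxA -[BB *m _]adjK adjM adjK V0E Sadj.
pose D := block_diag (fun x => psd_sqrt (rho x x)).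
have D_psd : psd D by apply: psd_block_diag => x; apply: psd_psd_sqrt.
have DD : D *m D = block_diag (fun x => rho x x).
  rewrite block_diagM; apply: blockmx_ext => x i y j; rewrite !blockmxE.
  by rewrite psd_sqrtK.
(* Gamma and D^2 share their diagonal blocks, so Powers and Stormer leave only the off-diagonal
   rho^(x,y) to bound. *)
have SD : fnorm2 (S - D) <= ((dL%:R * Num.sqrt nu)%:C)%C ^+ 2.
  have [K Kc hK] := powers_stormer S_psd D_psd; apply: (le_trans hK).
  rewrite -[leLHS]ger0_norm ?(le_trans (fnorm2_ge0 _) hK) //.
  rewrite SS DD; have -> : blockmx rho - block_diag (fun x => rho x x)
      = blockmx (fun x y => rho x y - (x == y)%:R *: rho x x).
    by apply: blockmx_ext => x i y j; rewrite !mxE !mxtens_indexK.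
  apply: (trace_norm_blocks Kc nu0) => [x|x y xy]; first by rewrite eqxx scale1r subrr.
  by rewrite (negbTE xy) scale0r subr0 htr.
(* The Kraus operators are transposed slices of W, which puts a transpose on W W^+ in the
   normalization condition. *)
exists (fun j => \matrix_(y, b) W b (mxtens_index (y, j))).
  have -> : \sum_j adj (\matrix_(y, b) W b (mxtens_index (y, j)))
      *m (\matrix_(y, b) W b (mxtens_index (y, j))) = (W *m adj W)^T :> 'M[C]_dB.
    apply/matrixP => b b'; rewrite summxE !mxE sum_mxtens exchange_big.
    apply: eq_bigr => j _; rewrite mxE; apply: eq_bigr => y _.
    by rewrite !mxE mulrC.
  rewrite -[1%:M]trmx1 -linearB; apply: psd_tr.
  by have /psd_sub1_contraction := contraction_adj Wc; rewrite adjK.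
move=> dR F F1; pose H := F^T.
have H1 : fnorm2 H = 1.
  by rewrite -F1 !fnorm2E exchange_big; do 2![apply: eq_bigr => ? _]; rewrite mxE.
(* Three vectors for the input H: o is built from sqrt Gamma, s from sqrt D, and t is the ideal
   target with sqrt zeta, the rotations Q_x being moved onto it. [sine_triangle] compares o with t
   through s. *)
pose o := (H *t 1%:M) *m S; pose s := (H *t 1%:M) *m D.
pose t := (H *t Z) *m adj (block_diag Q).
(* For hermitian X the norm depends on X^2 only. For S and D these squares have blocks of trace 1 on
   the diagonal and 0 off it, so o and s are unit vectors. *)
have normE (X : 'M[C]_(dL * dE)) : adj X = X ->
    fnorm2 ((H *t 1%:M) *m X) = fip ((adj H *m H) *t 1%:M) (X *m X).
  move=> Xh; rewrite /fnorm2 fip_adj mulmxA adj_tens tensmx_mul adj_id mulmx1.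
  rewrite /fip Xh mxtrace_mulC -mulmxA; congr (\tr (_ *m _)).
  by rewrite adj_tens adjM adjK adj_id.
have trH : \sum_x ((adj H *m H) x x)^* = 1.
  by rewrite -rmorph_sum -[\sum_i _]/(fnorm2 H) H1 rmorph1.
have o1 : fnorm2 o = 1.
  rewrite /o normE // SS tens_blockmx fip_blockmx -[RHS]trH.
  apply: eq_bigr => x _; rewrite (bigD1 x) //= big1 ?addr0 => [|y yx].
    by rewrite fipZl /fip adj_id mul1mx rho_tr eqxx mulr1.
  by rewrite fipZl /fip adj_id mul1mx rho_tr eq_sym (negbTE yx) mulr0.
have s1 : fnorm2 s = 1.
  rewrite /s normE ?psd_adj // DD tens_blockmx fip_blockmx -[RHS]trH.
  apply: eq_bigr => x _; rewrite (bigD1 x) //= big1 ?addr0 => [|y yx].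
    by rewrite fipZl fipZr /fip adj_id mul1mx rho_tr eqxx !mulr1.
  by rewrite fipZl fipZr eq_sym (negbTE yx) mul0r mulr0.
have t1 : fnorm2 t <= 1.
  rewrite -fnorm2_adj /t adjM adjK (le_trans (contraction_fnorm2 _ _)) //.
    by apply: contraction_block_diag => x; apply/contraction_adj; case: (hV x).
  by rewrite fnorm2_adj fnorm2_tens H1 Z1 mul1r.
have hst : 1 - (eps%:C)%C ^+ 2 <= `|fip s t| ^+ 2.
  (* The overlap is the average of the fidelities with weights sum_r |H_rx|^2, which add up to 1. *)
  have -> : fip s t = ((\sum_x \sum_r complex.Re (`|H r x| ^+ 2) * fidelity (rho x x) zeta)%:C)%C.
    rewrite /s /t !tens_blockmx adj_block_diag !blockmx_diagM fip_blockmx exchange_big.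
    rewrite rmorph_sum; apply: eq_bigr => x _; rewrite rmorph_sum; apply: eq_bigr => r _.
    rewrite -!scalemxAl fipZl fipZr mulrA -normCKC mul1mx rmorphM; congr (_ * _).
      by symmetry; apply: RRe_real; rewrite rpredX // normr_real.
    symmetry; apply: etrans (trace_normE _) _; rewrite -(proj2 (hV x)) /fip adj_psd_sqrt // /Q adjK.
    by rewrite mxtrace_mulC mulmxA.
  set f := \sum_x _.
  have f_ge : Num.sqrt (1 - eps ^+ 2) <= f.
    have -> : Num.sqrt (1 - eps ^+ 2) = \sum_x \sum_r complex.Re (`|H r x| ^+ 2) * Num.sqrt (1 - eps ^+ 2).
      under eq_bigr do rewrite -mulr_suml; rewrite -mulr_suml -[LHS]mul1r; congr (_ * _).
      apply: (@complexI R); rewrite rmorph1 -H1 fnorm2E exchange_big rmorph_sum.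
      apply: eq_bigr => x _; rewrite rmorph_sum; apply: eq_bigr => r _.
      by symmetry; apply: RRe_real; rewrite rpredX // normr_real.
    apply: ler_sum => x _; apply: ler_sum => r _; apply: ler_wpM2l; last exact: hfid.
    by rewrite -ler0c RRe_real ?rpredX ?normr_real // exprn_ge0.
  have -> : `|(f%:C)%C| ^+ 2 = ((f ^+ 2)%:C)%C.
    by rewrite real_normK ?rmorphXn //; apply/complex_realP; exists f.
  have -> : 1 - (eps%:C)%C ^+ 2 = ((1 - eps ^+ 2)%:C)%C by rewrite rmorphB rmorphXn rmorph1.
  (* If 1 - eps^2 <= 0, [Num.sqrt] is 0 and the claim is trivial; otherwise f dominates the root and
     can be squared. *)
  rewrite lecR; have [le0|gt0] := leP (1 - eps ^+ 2) 0.
    by rewrite (le_trans le0) // sqr_ge0.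
  rewrite -[leLHS](sqr_sqrtr (ltW gt0)) ler_pXn2r ?nnegrE ?sqrtr_ge0 //.
  by rewrite (le_trans _ f_ge) ?sqrtr_ge0.
have hso : fnorm2 (s - o) <= ((dL%:R * Num.sqrt nu)%:C)%C ^+ 2.
  rewrite /s /o -mulmxBr; apply: le_trans (contraction_fnorm2 _ _) _.
    by apply: contraction_tens1; rewrite H1.
  by rewrite -opprB -scaleN1r /fnorm2 fipZl fipZr mulrA -normCKC normrN1 expr1n mul1r.
have w0 : 0 <= ((dL%:R * Num.sqrt nu)%:C)%C by rewrite ler0c mulr_ge0 ?sqrtr_ge0.
have := sine_triangle o1 s1 t1 _ w0 hst hso; rewrite ler0c => /(_ eps0).
rewrite -rmorphD => /le_trans; apply.
(* X collects the amplitudes of all pairs of a recovery and a noise Kraus operator. Its inner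
   product with the unit matrix Z is <o, t> up to conjugation, so Cauchy-Schwarz bounds |<o, t>|^2
   by the full sum of squares. *)
pose X : 'M[C]_dE := \matrix_(i, j) \tr ((\matrix_(y, b) W b (mxtens_index (y, j))) *m M i *m (F *m adj F)).
have XE : X = \sum_x \sum_y (F *m adj F) x y *: block (BB *m W) x y.
  apply/matrixP => i j; rewrite mxE mxtrace_mulC summxE; apply: eq_bigr => x _.
  rewrite mxE summxE; apply: eq_bigr => y _; rewrite [RHS]mxE; congr (_ * _).
  rewrite !mxE; apply: eq_bigr => b _.
  by rewrite !mxE !mxtens_indexK mulrC.
have -> : fip o t = (fip Z X)^*.
  rewrite fipC; congr (_^*).
  have -> : fip t o = fip ((adj H *m H) *t Z) (BB *m W).
    rewrite /t /o BW /fip adjM adjK -!mulmxA mxtrace_mulC -!mulmxA.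
    by rewrite mulmxA !adj_tens tensmx_mul adjM adjK mulmx1.
  rewrite -[BB *m W]blockK tens_blockmx fip_blockmx XE /fip mulmx_sumr raddf_sum.
  apply: eq_bigr => x _; rewrite mulmx_sumr raddf_sum; apply: eq_bigr => y _.
  rewrite -/(fip _ _) -[RHS]/(fip Z _) fipZl fipZr; congr (_ * _).
  rewrite !mxE rmorph_sum; apply: eq_bigr => r _.
  by rewrite !mxE rmorphM /= conjCK mulrC.
rewrite norm_conjC (le_trans (fip_CS _ _)) // Z1 mul1r fnorm2E exchange_big.
by apply: ler_sum => j _; apply: ler_sum => i _; rewrite mxE.
Qed.

End Recovery.
(** * Kraus operators and entanglement fidelity *)
Section Channels.
Variable R : realType.
Local Notation C := R[i].

(** Vectors of a tensor product are identified with matrices: the state with matrix F has reduced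
    state F F^+ on the first factor, and K (x) id sends F to K F. *)
Definition col_unvec n k (phi : 'cV[C]_(n * k)) : 'M[C]_(n, k) :=
  \matrix_(i, r) phi (mxtens_index (i, r)) 0.

Definition col_vec n k (F : 'M[C]_(n, k)) : 'cV[C]_(n * k) :=
  \col_l F (mxtens_unindex l).1 (mxtens_unindex l).2.

Lemma col_unvecK n k (phi : 'cV[C]_(n * k)) : col_vec (col_unvec phi) = phi.
Proof. by apply/colP => l; rewrite !mxE mxtens_unindexK. Qed.

Lemma fip_col_vec n k (F G : 'M[C]_(n, k)) : fip (col_vec F) (col_vec G) = fip F G.
Proof.
rewrite !fipE sum_mxtens; apply: eq_bigr => i _; apply: eq_bigr => r _.
by rewrite big_ord1 !mxE !mxtens_indexK.
Qed.

Lemma fnorm2_unit n (phi : 'cV[C]_n) : adj phi *m phi = 1%:M <-> fnorm2 phi = 1.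
Proof.
rewrite /fnorm2 /fip; split=> [->|h]; first by rewrite mxtrace1.
by rewrite [LHS]mx11_scalar -h mxtrace11.
Qed.

(** For the rank one projector P onto phi, P rho P = c P with c = <phi, rho phi>; its square root is
    sqrt(c) P, of trace sqrt(c). *)
Lemma fidelity_pure n (rho : 'M[C]_n) (phi : 'cV[C]_n) : psd rho -> fnorm2 phi = 1 ->
  ((fidelity rho (phi *m adj phi))%:C)%C ^+ 2 = fip phi (rho *m phi).
Proof.
move=> hrho phi1; have phiK := (fnorm2_unit phi).2 phi1.
have proj_psd : psd (phi *m adj phi) by rewrite -{1}[phi]adjK; apply: psd_gram.
rewrite /fidelity (@psd_sqrtE _ _ (phi *m adj phi) (phi *m adj phi)) //; last first.
  by rewrite mulmxA -[_ *m adj phi *m phi]mulmxA phiK mulmx1.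
rewrite trace_normE; set c := fip phi _.
have c_ge0 : 0 <= c by move/psdP: hrho; apply.
rewrite (@psd_sqrtE _ _ _ (sqrtC c *: (phi *m adj phi))).
- by rewrite linearZ /= mxtrace_mulC phiK mxtrace1 mulr1 sqrtCK.
- apply/psdP => v; rewrite -scalemxAl fipZr mulr_ge0 ?sqrtC_ge0 //.
  by move/psdP: proj_psd; apply.
rewrite -scalemxAl -scalemxAr scalerA -expr2 sqrtCK.
rewrite !adjM adjK adj_psd_sqrt // !mulmxA -[_ *m adj phi *m phi]mulmxA phiK mulmx1.
rewrite -[_ *m psd_sqrt rho *m psd_sqrt rho]mulmxA psd_sqrtK //.
rewrite -[phi *m adj phi *m rho]mulmxA -[phi *m _ *m phi]mulmxA [adj phi *m rho *m phi]mx11_scalar.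
by rewrite mul_mx_scalar -scalemxAl /c /fip mxtrace11 mulmxA.
Qed.

Lemma tens_id_kraus (J : finType) n m (K : J -> 'M[C]_(m, n)) (Phi : 'M[C]_n -> 'M[C]_m) dR
    (F : 'M[C]_(n, dR)) : (forall X, Phi X = \sum_j K j *m X *m adj (K j)) ->
  tens_id Phi (col_vec F *m adj (col_vec F))
  = \sum_j col_vec (K j *m F) *m adj (col_vec (K j *m F)).
Proof.
move=> PhiE; apply: blockmx_ext => i r i' s.
rewrite summxE (bigD1 r) //= summxE [X in _ + X]big1 ?addr0; last first.
  move=> r' r'r; rewrite summxE big1 // => s' _.
  by rewrite tensmxE mxE eq_sym (negbTE r'r) mulr0.
rewrite (bigD1 s) //= big1 ?addr0; last first.
  by move=> s' s's; rewrite tensmxE mxE [s == s']eq_sym (negbTE s's) andbF mulr0.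
rewrite tensmxE mxE !eqxx mulr1 PhiE !summxE; apply: eq_bigr => j _.
have -> : \matrix_(a, b) (col_vec F *m adj (col_vec F)) (mxtens_index (a, r)) (mxtens_index (b, s))
   = col r F *m adj (col s F).
  by apply/matrixP => a b; rewrite !mxE !big_ord1 !mxE !mxtens_indexK.
rewrite mulmxA -mulmxA -adjM !colE !mulmxA -!colE.
by rewrite !mxE !big_ord1 !mxE !mxtens_indexK.
Qed.

Lemma tens_id_id n dR (X : 'M[C]_(n * dR)) : tens_id id X = X.
Proof.
apply: blockmx_ext => i r i' s.
rewrite summxE (bigD1 r) //= summxE [X in _ + X]big1 ?addr0; last first.
  move=> r' r'r; rewrite summxE big1 // => s' _.
  by rewrite tensmxE [X in _ * X]mxE [r == _]eq_sym (negbTE r'r) mulr0.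
rewrite (bigD1 s) //= big1 ?addr0; last first.
  by move=> s' s's; rewrite tensmxE [X in _ * X]mxE [s == s']eq_sym (negbTE s's) andbF mulr0.
by rewrite tensmxE !mxE !eqxx mulr1.
Qed.

(** The output is the sum of the rank one operators of the vectors K_j F, and the overlap of K_j F
    with F is, up to conjugation, the trace of K_j F F^+. *)
Lemma ent_fidelity_kraus (J : finType) n (K : J -> 'M[C]_n) (Phi : 'M[C]_n -> 'M[C]_n) dR
    (F : 'M[C]_(n, dR)) :
  (forall X, Phi X = \sum_j K j *m X *m adj (K j)) -> fnorm2 F = 1 ->
  ((ent_fidelity (col_vec F) Phi id)%:C)%C ^+ 2
  = \sum_j `|\tr (K j *m (F *m adj F))| ^+ 2.
Proof.
move=> PhiE F1; rewrite /ent_fidelity tens_id_id (tens_id_kraus _ PhiE) fidelity_pure.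
- rewrite mulmx_suml /fip mulmx_sumr raddf_sum; apply: eq_bigr => j _.
  rewrite -[LHS]/(fip _ _) -mulmxA.
  have -> : adj (col_vec (K j *m F)) *m col_vec F = (fip (K j *m F) F)%:M.
    by rewrite [LHS]mx11_scalar -mxtrace11 -[X in X%:M]/(fip _ _) fip_col_vec.
  rewrite mul_mx_scalar fipZr fip_col_vec [fip (K j *m F) F]fipC mulrC -normCK.
  by rewrite /fip mxtrace_mulC mulmxA.
- apply: psd_sum => j; rewrite -{1}[col_vec _]adjK; exact: psd_gram.
- by rewrite -F1 /fnorm2 fip_col_vec.
Qed.

Lemma ent_fidelity_ge0 n m dR (phi : 'cV[C]_(n * dR)) (K K' : 'M[C]_n -> 'M[C]_m) :
  0 <= ent_fidelity phi K K'.
Proof. exact: trace_norm_ge0. Qed.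

(** Serves to bound the set whose supremum is [f_worst]: Cauchy-Schwarz bounds each term by |K_j
    F|^2, and these sum to |F|^2. *)
Lemma kraus_overlap_le1 (J : finType) n dR (K : J -> 'M[C]_n) (F : 'M[C]_(n, dR)) :
  \sum_j adj (K j) *m K j = 1%:M -> fnorm2 F = 1 ->
  \sum_j `|\tr (K j *m (F *m adj F))| ^+ 2 <= 1.
Proof.
move=> K1 F1; apply: (@le_trans _ _ (\sum_j fnorm2 (K j *m F))).
  apply: ler_sum => j _; rewrite mulmxA mxtrace_mulC -/(fip _ _).
  by rewrite (le_trans (fip_CS _ _)) // F1 mul1r.
rewrite -[leRHS]F1 /fnorm2 -{4}[F]mul1mx -K1 mulmx_suml /fip mulmx_sumr raddf_sum.
by apply: ler_sum => j _; rewrite adjM !mulmxA.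
Qed.

Definition stinespring_kraus m k n (W : 'M[C]_(m * k, n)) (e : 'I_k) : 'M[C]_(m, n) :=
  \matrix_(b, x) W (mxtens_index (b, e)) x.

Lemma isometry_kraus m k n (W : 'M[C]_(m * k, n)) :
  adj W *m W = \sum_e adj (stinespring_kraus W e) *m stinespring_kraus W e.
Proof.
apply/matrixP => i j; rewrite mxE sum_mxtens exchange_big summxE; apply: eq_bigr => e _.
by rewrite mxE; apply: eq_bigr => b _; rewrite !mxE.
Qed.

(** Reduces partial traces to a comparison of rows: a row of W and the matching row of a Kraus
    operator coincide although the matrices have different sizes. *)
Lemma conj_mx_entry m n (A B : 'M[C]_(m, n)) (X : 'M[C]_n) i j :
  (A *m X *m adj B) i j = (row i A *m X *m adj (row j B)) 0 0.
Proof.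
rewrite !mxE; apply: eq_bigr => k _; rewrite !mxE; congr (_ * _).
by apply: eq_bigr => l _; rewrite !mxE.
Qed.

Lemma ptrace2_kraus m k n (W : 'M[C]_(m * k, n)) X : ptrace2 (W *m X *m adj W)
  = \sum_e stinespring_kraus W e *m X *m adj (stinespring_kraus W e).
Proof.
apply/matrixP => i j; rewrite mxE summxE; apply: eq_bigr => e _.
rewrite conj_mx_entry [RHS]conj_mx_entry; congr ((_ *m X *m adj _) 0 0);
by apply/rowP => l; rewrite !mxE.
Qed.

Lemma ptrace1_kraus m k n (W : 'M[C]_(m * k, n)) X i j : ptrace1 (W *m X *m adj W) i j
  = \tr (stinespring_kraus W i *m X *m adj (stinespring_kraus W j)).
Proof.
rewrite mxE; apply: eq_bigr => b _.
rewrite conj_mx_entry [RHS]conj_mx_entry; congr ((_ *m X *m adj _) 0 0);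
by apply/rowP => l; rewrite !mxE.
Qed.

Lemma channel_kraus n m (Phi : 'M[C]_n -> 'M[C]_m) : is_channel Phi ->
  exists k, exists2 K : 'I_k -> 'M[C]_(m, n),
    \sum_e adj (K e) *m K e = 1%:M & forall X, Phi X = \sum_e K e *m X *m adj (K e).
Proof.
move=> [k [W [W1 PhiE]]]; exists k, (stinespring_kraus W); first by rewrite -isometry_kraus.
by move=> X; rewrite PhiE ptrace2_kraus.
Qed.

Lemma kraus_channel (J : finType) n m (K : J -> 'M[C]_(m, n)) :
  \sum_j adj (K j) *m K j = 1%:M -> is_channel (fun X => \sum_j K j *m X *m adj (K j)).
Proof.
move=> K1; pose W : 'M[C]_(m * #|J|, n) :=
  \matrix_(l, x) K (enum_val (mxtens_unindex l).2) (mxtens_unindex l).1 x.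
have WE e : stinespring_kraus W e = K (enum_val e).
  by apply/matrixP => b x; rewrite !mxE mxtens_indexK.
exists #|J|, W; split=> [|X].
  apply: etrans (isometry_kraus W) _.
  rewrite -K1 [RHS](reindex (@enum_val J predT)); last exact: onW_bij (enum_val_bij _).
  by apply: eq_bigr => e _; rewrite WE.
rewrite ptrace2_kraus [LHS](reindex (@enum_val J predT)); last exact: onW_bij (enum_val_bij _).
by apply: eq_bigr => e _; rewrite WE.
Qed.

(** The missing weight T^2 is supplied by operators |l0><b| T, which discard the input and prepare a
    fixed ket; a positive dimension provides l0. *)
Lemma kraus_completion (J : finType) dL dB (Rec : J -> 'M[C]_(dL, dB)) : (0 < dL)%N ->
  psd (1%:M - \sum_j adj (Rec j) *m Rec j) ->
  exists2 Rec' : J + 'I_dB -> 'M[C]_(dL, dB), \sum_j adj (Rec' j) *m Rec' j = 1%:M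
    & forall j, Rec' (inl j) = Rec j.
Proof.
move=> dL0 hRec; pose T := psd_sqrt (1%:M - \sum_j adj (Rec j) *m Rec j).
pose l0 := Ordinal dL0.
exists (fun j => match j with inl j => Rec j | inr b => delta_mx l0 b *m T end) => //.
rewrite big_sumType /=.
have -> : \sum_b adj (delta_mx l0 b *m T) *m (delta_mx l0 b *m T) = T *m T.
  rewrite -[X in _ = _ *m X]mul1mx mx1_sum_delta mulmx_suml mulmx_sumr; apply: eq_bigr => b _.
  by rewrite adjM adj_delta adj_psd_sqrt // !mulmxA -[T *m _ *m delta_mx _ _]mulmxA mul_delta_mx.
by rewrite psd_sqrtK // addrC subrK.
Qed.

(** Reduces the bound to an estimate on Kraus overlaps for a subnormalized recovery, since
    completing the recovery only adds nonnegative terms to the squared fidelity. *)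
Lemma eps_worst_le (I J : finType) dL dB (M : 'M[C]_dL -> 'M[C]_dB)
    (K : J -> 'M[C]_(dB, dL)) (Rec : I -> 'M[C]_(dL, dB)) (delta : R) :
  (0 < dL)%N -> \sum_j adj (K j) *m K j = 1%:M ->
  (forall X, M X = \sum_j K j *m X *m adj (K j)) ->
  psd (1%:M - \sum_i adj (Rec i) *m Rec i) -> 0 <= delta ->
  (forall dR (F : 'M[C]_(dL, dR)), fnorm2 F = 1 ->
    1 - (delta%:C)%C ^+ 2 <= \sum_i \sum_j `|\tr (Rec i *m K j *m (F *m adj F))| ^+ 2) ->
  eps_worst M <= delta.
Proof.
move=> dL0 K1 ME hRec delta0 hF.
have comp_kraus (I' : finType) (Q : I' -> 'M[C]_(dL, dB)) (Phi : 'M[C]_dB -> 'M[C]_dL) :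
    (forall X, Phi X = \sum_i Q i *m X *m adj (Q i)) -> forall X, (Phi \o M) X
    = \sum_(p : I' * J) (Q p.1 *m K p.2) *m X *m adj (Q p.1 *m K p.2).
  move=> PhiE X; rewrite /= PhiE ME -(pair_bigA _ (fun i j => Q i *m K j *m X *m adj (Q i *m K j))).
  apply: eq_bigr => i _; rewrite mulmx_sumr mulmx_suml; apply: eq_bigr => j _.
  by rewrite adjM !mulmxA.
have comp_complete (I' : finType) (Q : I' -> 'M[C]_(dL, dB)) :
    \sum_i adj (Q i) *m Q i = 1%:M ->
    \sum_(p : I' * J) adj (Q p.1 *m K p.2) *m (Q p.1 *m K p.2) = 1%:M.
  move=> Q1; rewrite -(pair_bigA _ (fun i j => adj (Q i *m K j) *m (Q i *m K j))).
  rewrite exchange_big -K1; apply: eq_bigr => j _ /=.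
  rewrite -[X in _ = _ *m X]mul1mx -Q1 mulmx_suml mulmx_sumr; apply: eq_bigr => i _.
  by rewrite adjM !mulmxA.
pose fids (Phi : 'M[C]_dB -> 'M[C]_dL) := [set g : R | exists dR : nat,
  exists phi : 'cV[C]_(dL * dR), adj phi *m phi = 1%:M /\ g = ent_fidelity phi (Phi \o M) id]%classic.
have fids_lb Phi : lbound (fids Phi) 0.
  by move=> g [dR [phi [_ ->]]]; apply: ent_fidelity_ge0.
(* A basis state with one-dimensional reference, witnessing that the sets of fidelities are
   nonempty. *)
pose F0 : 'M[C]_(dL, 1) := delta_mx (Ordinal dL0) 0.
have F01 : fnorm2 F0 = 1.
  by rewrite /fnorm2 /fip adj_delta mul_delta_mx mxtrace11 mxE !eqxx.
have fids0 Phi : fids Phi (ent_fidelity (col_vec F0) (Phi \o M) id).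
  by exists 1%N, (col_vec F0); split=> //; apply/fnorm2_unit; rewrite /fnorm2 fip_col_vec.
pose c := Num.sqrt (1 - delta ^+ 2).
have c2 : 1 - delta ^+ 2 <= c ^+ 2.
  have [le0|gt0] := leP (1 - delta ^+ 2) 0; first by rewrite (le_trans le0) // sqr_ge0.
  by rewrite sqr_sqrtr // ltW.
have c_le : c <= f_worst M.
  have [Rec' Rec'1 Rec'E] := kraus_completion dL0 hRec.
  pose Phi X := \sum_i Rec' i *m X *m adj (Rec' i).
  apply: (@le_trans _ _ (inf (fids Phi))).
    apply: lb_le_inf; first by exists (ent_fidelity (col_vec F0) (Phi \o M) id).
    move=> _ [dR [phi [/fnorm2_unit phi1 ->]]].
    rewrite -[phi]col_unvecK; set F := col_unvec phi.
    have F1 : fnorm2 F = 1 by rewrite /fnorm2 -fip_col_vec col_unvecK.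
    have := hF _ _ F1; have := ent_fidelity_kraus (comp_kraus _ Rec' Phi (fun _ => erefl)) F1.
    set g := ent_fidelity _ _ _ => gE h.
    have g0 : 0 <= g by apply: ent_fidelity_ge0.
    have : 1 - (delta%:C)%C ^+ 2 <= (g%:C)%C ^+ 2.
      apply: (le_trans h); rewrite gE -(pair_bigA _ (fun i j => `|\tr (Rec' i *m K j *m (F *m adj F))| ^+ 2)).
      rewrite big_sumType /=; under eq_bigr do under eq_bigr do rewrite -Rec'E.
      by rewrite lerDl; do 2![apply: sumr_ge0 => ? _]; rewrite exprn_ge0.
    rewrite -!rmorphXn -(rmorph1 (real_complex R)) -rmorphB lecR => hg.
    by rewrite -[g]ger0_norm // -sqrtr_sqr ler_wsqrtr.
  apply: ub_le_sup; last by exists Phi; split; [apply: kraus_channel|].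
  (* The supremum is over a bounded set: each infimum is at most the fidelity at [F0], hence at most
     1. *)
  exists 1 => f [Psi [/channel_kraus[k [Q Q1 QE]] ->]].
  apply: (@le_trans _ _ (ent_fidelity (col_vec F0) (Psi \o M) id)).
    by apply: ge_inf; [exists 0; apply: fids_lb | apply: fids0].
  rewrite -(@ler_pXn2r _ 2) ?nnegrE ?ent_fidelity_ge0 // expr1n -lecR rmorphXn.
  have := kraus_overlap_le1 (comp_complete _ Q Q1) F01.
  by rewrite -(ent_fidelity_kraus (comp_kraus _ Q Psi QE) F01).
rewrite /eps_worst -[leRHS]ger0_norm // -sqrtr_sqr ler_wsqrtr // lerBlDr -lerBlDl.
rewrite (le_trans c2) // ler_pXn2r ?nnegrE ?sqrtr_ge0 //.
by rewrite (le_trans _ c_le) ?sqrtr_ge0.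
Qed.

End Channels.

(** * From the complementary channel to a recovery, in any orthonormal basis *)

Section Complementary.
Variable R : realType.
Local Notation C := R[i].

(** The Kraus operators K_i U express the channel in the basis of columns of U, so their Gram blocks
    are the given rho^(x,x'). The recovery found there is rotated back by U, and an input F becomes
    U^+ F. *)
Lemma complementary_recovery dL dB dE (M : 'M[C]_dL -> 'M[C]_dB) (Mhat : 'M[C]_dL -> 'M[C]_dE)
    (U : 'M[C]_dL) (zeta : 'M[C]_dE) (eps nu : R) :
  adj U *m U = 1%:M -> 0 <= eps -> 0 <= nu -> is_complementary M Mhat -> density zeta ->
  (forall x, Num.sqrt (1 - eps ^+ 2) <= fidelity (Mhat (col x U *m adj (col x U))) zeta) ->
  (forall x x', x != x' -> trace_norm (Mhat (col x U *m adj (col x' U))) <= nu) ->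
  exists K : 'I_dE -> 'M[C]_(dB, dL), exists Rec : 'I_dE -> 'M[C]_(dL, dB),
  [/\ \sum_i adj (K i) *m K i = 1%:M, forall X, M X = \sum_i K i *m X *m adj (K i),
      psd (1%:M - \sum_j adj (Rec j) *m Rec j)
    & forall dR (F : 'M[C]_(dL, dR)), fnorm2 F = 1 ->
      1 - ((eps + dL%:R * Num.sqrt nu)%:C)%C ^+ 2 <=
      \sum_j \sum_i `|\tr (Rec j *m K i *m (F *m adj F))| ^+ 2].
Proof.
move=> U1 eps0 nu0 [W [W1 [ME MhatE]]] hzeta hfid htr.
have U2 : U *m adj U = 1%:M by apply: mulmx1C.
pose K := stinespring_kraus W.
have K1 : \sum_i adj (K i) *m K i = 1%:M by rewrite -isometry_kraus.
pose KU i := K i *m U.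
have KU1 : \sum_i adj (KU i) *m KU i = 1%:M.
  rewrite -U1 -[X in _ = _ *m X]mul1mx -K1 mulmx_suml mulmx_sumr.
  by apply: eq_bigr => i _; rewrite adjM !mulmxA.
have rhoE x y : (\matrix_(i < dE, b < dB) KU i b x) *m adj (\matrix_(i < dE, b < dB) KU i b y)
    = Mhat (col x U *m adj (col y U)).
  apply/matrixP => i j; rewrite MhatE ptrace1_kraus mulmxA -mulmxA -adjM !colE !mulmxA -!colE.
  rewrite mxE; apply: eq_bigr => b _.
  by rewrite !mxE big_ord1 !mxE.
have [x|x y xy|Rec Rec1 RecF] := @recovery_kraus _ _ _ _ KU zeta eps nu KU1 hzeta eps0 nu0.
- by rewrite rhoE.
- by rewrite rhoE htr.
exists K, (fun j => U *m Rec j); split=> [|X||dR F F1]; first exact: K1.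
- by rewrite ME ptrace2_kraus.
- under eq_bigr do rewrite adjM mulmxA -[_ *m adj U *m U]mulmxA U1 mulmx1.
  exact: Rec1.
have F'1 : fnorm2 (adj U *m F) = 1.
  by rewrite /fnorm2 fip_adj adjK mulmxA U2 mul1mx.
apply: le_trans (RecF _ _ F'1) _; rewrite le_eqVlt; apply/orP; left; apply/eqP.
apply: eq_bigr => j _; apply: eq_bigr => i _; congr (`|_| ^+ 2).
rewrite adjM adjK /KU -!mulmxA [RHS]mxtrace_mulC -!mulmxA.
by rewrite [U *m (adj U *m _)]mulmxA U2 mul1mx.
Qed.

End Complementary.

(** * Attaching a classical record *)

Section ClassicalRecord.
Variable R : realType.
Local Notation C := R[i].

(** The operator a (x) 1, given entrywise so that its columns are indexed by [dB] and not by
    [1 * dB]. *)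
Definition tens_col dC dB (a : 'cV[C]_dC) : 'M[C]_(dC * dB, dB) :=
  \matrix_(l, b) (a (mxtens_unindex l).1 0 * ((mxtens_unindex l).2 == b)%:R).

Lemma adj_tens_colM dC dB (a a' : 'cV[C]_dC) :
  adj (tens_col dB a) *m tens_col dB a' = (fip a a')%:M.
Proof.
apply/matrixP => b b'; rewrite mxE sum_mxtens mxE fipE -sumrMnl.
apply: eq_bigr => c _; rewrite big_ord1 (bigD1 b) //= big1 ?addr0 => [|b'' /negbTE hb].
  by rewrite adjE !mxE !mxtens_indexK /= eqxx mulr1 mulr_natr mulrnAr.
by rewrite adjE mxE mxtens_indexK /= hb mulr0 rmorph0 mul0r.
Qed.

Lemma tens_col_conj dC dB (a : 'cV[C]_dC) (X : 'M[C]_dB) :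
  tens_col dB a *m X *m adj (tens_col dB a) = (a *m adj a) *t X.
Proof.
have E c b m (Y : 'M[C]_(dB, m)) j :
    (tens_col dB a *m Y) (mxtens_index (c, b)) j = a c 0 * Y b j.
  rewrite mxE (bigD1 b) //= big1 ?addr0 => [|b' /negbTE hb].
    by rewrite mxE mxtens_indexK eqxx mulr1.
  by rewrite mxE mxtens_indexK /= eq_sym hb mulr0 mul0r.
apply: blockmx_ext => c b c' b'.
rewrite -mulmxA E tensmxE -[X *m _]adjK adjE adjM adjK E adjE.
by rewrite rmorphM /= conjCK mxE big_ord1 adjE mulrA.
Qed.

End ClassicalRecord.

Theorem theorem3
  (R : realType) (dL dA : nat) (HdL : (0 < dL)%N)
  (E : 'M[R[i]]_dL -> 'M[R[i]]_dA) (HE : is_channel E)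
  (U : 'M[R[i]]_dL) (HU : adj U *m U = 1%:M)
  (eps nu : R) (Heps : 0 <= eps) (Hnu : 0 <= nu) :
  let ket x := col x U in
  let kb x x' := ket x *m adj (ket x') in
  (* part 1: general noise *)
  (forall (dB : nat) (N : 'M[R[i]]_dA -> 'M[R[i]]_dB), is_channel N ->
   forall (dE : nat) (Nhat : 'M[R[i]]_dL -> 'M[R[i]]_dE),
   is_complementary (N \o E) Nhat ->
   forall zeta : 'M[R[i]]_dE, density zeta ->
   (forall x, Num.sqrt (1 - eps ^+ 2) <= fidelity (Nhat (kb x x)) zeta) ->
   (forall x x', x != x' -> trace_norm (Nhat (kb x x')) <= nu) ->
   eps_worst (N \o E) <= eps + dL%:R * Num.sqrt nu)
  /\
  (* part 2: noise with classical record *)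
  (forall (k : nat) (q : 'I_k -> R),
   (forall al, 0 <= q al) -> \sum_(al < k) q al = 1 ->
   forall (dC : nat) (a : 'I_k -> 'cV[R[i]]_dC),
   (forall al be, adj (a al) *m a be = (al == be)%:R%:M) ->
   forall (dB : nat) (Na : 'I_k -> 'M[R[i]]_dA -> 'M[R[i]]_dB),
   (forall al, is_channel (Na al)) ->
   forall (dEa : 'I_k -> nat)
     (Nhata : forall al, 'M[R[i]]_dL -> 'M[R[i]]_(dEa al)),
   (forall al, is_complementary (Na al \o E) (Nhata al)) ->
   forall zetaa : forall al, 'M[R[i]]_(dEa al),
   (forall al, density (zetaa al)) ->
   (forall al x,
      Num.sqrt (1 - eps ^+ 2) <= fidelity (Nhata al (kb x x)) (zetaa al)) ->
   (forall al x x', x != x' -> trace_norm (Nhata al (kb x x')) <= nu) ->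
   let N (X : 'M[R[i]]_dA) : 'M[R[i]]_(dC * dB) :=
     \sum_(al < k) (((q al)%:C)%C *: ((a al *m adj (a al)) *t Na al X)) in
   eps_worst (N \o E) <= eps + dL%:R * Num.sqrt nu).
Proof.
move=> ket kb.
have delta0 : 0 <= eps + dL%:R * Num.sqrt nu by rewrite addr_ge0 ?mulr_ge0 ?sqrtr_ge0.
split=> [dB N _ dE Nhat NE zeta hzeta hfid htr|].
  have [K [Rec [K1 KE Rec1 RecF]]] := complementary_recovery HU Heps Hnu NE hzeta hfid htr.
  exact: (eps_worst_le HdL K1 KE Rec1 delta0 RecF).
move=> k q q0 q1 dC a a_orth dB Na _ dEa Nhata NE zetaa hzeta hfid htr; cbv zeta.
have hrec al := complementary_recovery HU Heps Hnu (NE al) (hzeta al) (hfid al) (htr al).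
(* Choice turns the Kraus families and recoveries found for each record value into functions of
   al. *)
pose K al := sval (cid (hrec al)); pose hK al := svalP (cid (hrec al)).
pose Rec al := sval (cid (hK al)); pose hRec al := svalP (cid (hK al)).
pose I_ al := tens_col dB (a al).
have II al be : adj (I_ al) *m I_ be = (al == be)%:R%:M.
  by rewrite adj_tens_colM /fip a_orth mxtrace11 mxE eqxx mulr1n.
pose s al : R[i] := sqrtC ((q al)%:C)%C.
have qC0 al : 0 <= ((q al)%:C)%C :> R[i] by rewrite ler0c.
have q1C : \sum_al ((q al)%:C)%C = 1 :> R[i] by rewrite -rmorph_sum q1 rmorph1.
have s2 al : s al * (s al)^* = ((q al)%:C)%C.
  by rewrite -normCK ger0_norm ?sqrtC_ge0 // sqrtCK.
(* Kraus indices are dependent pairs because the environment dimension varies with al. The noise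
   operators are sqrt(q_al) |al> (x) K_e, and the recovery ones first project on the record al. *)
pose J := {al : 'I_k & 'I_(dEa al)}.
pose KJ (p : J) := s (tag p) *: (I_ (tag p) *m K (tag p) (tagged p)).
pose RJ (p : J) := Rec (tag p) (tagged p) *m adj (I_ (tag p)).
have sumJ (V : nmodType) (f : forall al, 'I_(dEa al) -> V) :
    \sum_(p : J) f (tag p) (tagged p) = \sum_al \sum_e f al e.
  by rewrite (sig_big_dep xpredT (fun _ => xpredT)).
apply: (@eps_worst_le _ _ _ _ _ _ KJ RJ) => //.
- rewrite (sumJ _ (fun al e => adj (s al *: (I_ al *m K al e)) *m (s al *: (I_ al *m K al e)))).
  rewrite -[RHS]scale1r -[X in _ = X *: _]q1C scaler_suml.
  apply: eq_bigr => al _; have [K1 _ _ _] := hRec al.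
  rewrite -[in RHS]K1 scaler_sumr; apply: eq_bigr => e _.
  rewrite adj_scale -scalemxAl -scalemxAr scalerA mulrC s2 adjM -mulmxA [adj (I_ al) *m _]mulmxA.
  by rewrite II eqxx mul1mx.
- move=> X.
  rewrite (sumJ _ (fun al e =>
    (s al *: (I_ al *m K al e)) *m X *m adj (s al *: (I_ al *m K al e)))).
  rewrite /=; apply: eq_bigr => al _; have [_ KE _ _] := hRec al.
  have /= -> := KE X; rewrite -tens_col_conj mulmx_sumr mulmx_suml scaler_sumr.
  apply: eq_bigr => e _.
  by rewrite adj_scale -!scalemxAl -scalemxAr scalerA s2 adjM !mulmxA.
- rewrite (sumJ _ (fun al j => adj (Rec al j *m adj (I_ al)) *m (Rec al j *m adj (I_ al)))).
  pose P := \sum_al I_ al *m adj (I_ al).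
  have Ph : adj P = P by rewrite adj_sum; apply: eq_bigr => al _; rewrite adjM adjK.
  have PP : P *m P = P.
    rewrite {1}/P mulmx_suml; apply: eq_bigr => al _; rewrite mulmx_sumr (bigD1 al) //= big1 ?addr0.
      by rewrite mulmxA -[_ *m adj (I_ al) *m _]mulmxA II eqxx mulmx1.
    move=> be /negbTE h; rewrite mulmxA -[_ *m adj (I_ al) *m _]mulmxA II eq_sym h.
    by rewrite -scalemx1 scale0r mulmx0 mul0mx.
  (* The record states need not span C: the defect splits into the projector 1 - P outside their
     span and the defect of each recovery on its own sector. *)
  have -> : 1%:M - \sum_al \sum_j adj (Rec al j *m adj (I_ al)) *m (Rec al j *m adj (I_ al))
     = adj (1%:M - P) *m (1%:M - P)
       + \sum_al adj (adj (I_ al)) *m (1%:M - \sum_j adj (Rec al j) *m Rec al j) *m adj (I_ al).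
    rewrite adjB adj_id Ph mulmxBr mulmxBl mulmxBl !mulmx1 !mul1mx PP subrr subr0.
    rewrite -addrA; congr (_ + _).
    rewrite [in RHS]/P addrC -sumrB -sumrN; apply: eq_bigr => al _.
    rewrite adjK mulmxBr mulmx1 mulmxBl addrAC subrr add0r; congr (- _).
    rewrite mulmx_sumr mulmx_suml; apply: eq_bigr => j _.
    by rewrite adjM adjK !mulmxA.
  apply/psdP => v; rewrite mulmxDl fipDr addr_ge0 //.
    by have /psdP := psd_gram (1%:M - P); apply.
  have /psdP : psd (\sum_al adj (adj (I_ al)) *m (1%:M - \sum_j adj (Rec al j) *m Rec al j) *m adj (I_ al)).
    by apply: psd_sum => al; apply: psd_congr; have [] := hRec al.
  exact.
move=> dR F F1.
rewrite (sumJ _ (fun al j => \sum_p `|\tr (Rec al j *m adj (I_ al) *m KJ p *m (F *m adj F))| ^+ 2)).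
have -> : 1 - ((eps + dL%:R * Num.sqrt nu)%:C)%C ^+ 2
  = \sum_al ((q al)%:C)%C * (1 - ((eps + dL%:R * Num.sqrt nu)%:C)%C ^+ 2) :> R[i].
  by rewrite -mulr_suml q1C mul1r.
apply: ler_sum => al _; have [_ _ _ /(_ _ _ F1) h] := hRec al.
apply: le_trans (ler_wpM2l (qC0 al) h) _; rewrite mulr_sumr; apply: ler_sum => j _.
rewrite (sumJ _ (fun be e =>
  `|\tr (Rec al j *m adj (I_ al) *m (s be *: (I_ be *m K be e)) *m (F *m adj F))| ^+ 2)).
(* Only the noise terms carrying the record al that was read are kept, the others being nonnegative;
   the factor |s_al|^2 = q_al supplies the weight of the average. *)
rewrite (bigD1 al) //= -[leLHS]addr0 lerD //; last first.
  by do 2![apply: sumr_ge0 => ? _]; rewrite exprn_ge0.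
rewrite mulr_sumr; apply: ler_sum => e _.
rewrite -scalemxAr -scalemxAl linearZ /= normrM exprMn [`|s al| ^+ 2]normCK s2.
have -> // : Rec al j *m adj (I_ al) *m (I_ al *m K al e) = Rec al j *m K al e.
by rewrite -mulmxA [adj (I_ al) *m _]mulmxA II eqxx mul1mx.
Qed.
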